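(* Let $1\le d\le n$. The inner normal fan $\Sigma_{d,n}$ of the Catalan pellytope $\mathcal P_{d,n}$ is the chord diagram fan $\mathcal C_{d,n}$, whose maximal cones are the cones $C_D$ indexed by $d$-admissible chord diagrams $D$. More precisely: (1) A collection of rays of $\Sigma_{d,n}$ spans a cone of $\Sigma_{d,n}$ if and only if the corresponding $d$-chords are pairwise $d$-compatible. In particular, the maximal cones of $\Sigma_{d,n}$ are in bijection with $d$-admissible chord diagrams. (2) The fan $\Sigma_{d,n}$ is smooth, in particular simplicial, and flag. Moreover, for $d\ge 2$, $\Sigma_{d,n}$ is obtained from $\Sigma_{d-1,n}$ by a sequence of star subdivisions along the two-dimensional cones spanned by the rays corresponding to crossing chords $\overline{1j}$ and $\overline{i(n+3)}$ with $2\le i<j\le n+2$ and $j-i=d$. Each such star subdivision introduces a new ray, corresponding to the $d$-chord $\overline{ij}$.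
   Context: Let $[m]=\{1,\dots,m\}$. Let $f_1,\dots,f_n$ be the standard basis of $\mathbb R^n$ and $e_1,\dots,e_n$ the dual basis of $(\mathbb R^n)^*$. For $1\le k\le n$ and $1\le j\le n-k+1$ let $q_{k,j}=1+y_j+y_jy_{j+1}+\cdots+y_jy_{j+1}\cdots y_{j+k-1}$ and let $Q_{k,j}=\operatorname{Newt}(q_{k,j})\subset\mathbb R^n$ be its Newton polytope (the variable $y_i$ has exponent vector $f_i$). For $1\le d\le n$ the Catalan pellytope is the Minkowski sum $\mathcal P_{d,n}=\sum_{k=1}^{d}\sum_{j=1}^{n-k+1}Q_{k,j}$. Its inner normal fan $\Sigma_{d,n}\subset(\mathbb R^n)^*$ has as maximal cones the sets $\{w:\langle v,w\rangle\le\langle v',w\rangle\ \forall v'\in\mathcal P_{d,n}\}$, one for each vertex $v$ of $\mathcal P_{d,n}$. Chords. Consider a convex $(n+3)$-gon with vertices $1,\dots,n+3$ in cyclic order; a chord $\overline{ab}$ joins two non-adjacent vertices. The set $\mathcal Ch_d$ of $d$-chords consists of: $\overline{1i}$ for $3\le i\le n+2$; $\overline{j(n+3)}$ for $2\le j\le n+1$; and $\overline{ij}$ for $2\le i<j\le n+2$ with $2\le j-i\le d$. Chords correspond to vectors via $\overline{1(a+2)}\leftrightarrow -e_a$, $\overline{(b+1)(n+3)}\leftrightarrow e_b$ $(1\le a,b\le n)$ and $\overline{(i+1)(j+2)}\leftrightarrow e_i-e_j$ $(1\le i<j\le n)$; this identifies $\mathcal Ch_d$ with the ray generators of $\Sigma_{d,n}$.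 Two $d$-chords are $d$-compatible if either they do not cross (in the interior of the polygon), or they are of the form $\overline{1j}$ and $\overline{i(n+3)}$ with $2\le i<j\le n+2$ and $j-i\ge d+1$. A $d$-admissible chord diagram is a maximal collection of pairwise $d$-compatible $d$-chords. For a $d$-admissible chord diagram $D$, $C_D$ is the cone generated by the vectors corresponding to the chords in $D$; the chord diagram fan $\mathcal C_{d,n}$ is the collection of all cones $C_D$ ($D$ a $d$-admissible chord diagram), together with their faces. Fan notions. For a fan $\Sigma$, a cone is smooth if its primitive ray generators form part of a lattice basis of $\mathbb Z^n$; a fan is smooth if all its cones are. A simplicial fan is flag if any set of rays, every two of which span a cone of the fan, spans a cone of the fan. For a smooth cone $\tau\in\Sigma$ with ray set $\tau(1)$ and primitive ray generators $u_\rho$, put $u_\tau=\sum_{\rho\in\tau(1)}u_\rho$. The star subdivision of $\Sigma$ relative to $\tau$ is $\operatorname{Star}_\tau(\Sigma)=\{\sigma'\in\Sigma:\tau\not\subseteq\sigma'\}\cup\bigcup_{\sigma\in\Sigma,\ \sigma\supseteq\tau}\{\operatorname{cone}(A):A\subset\sigma(1)\cup\{u_\tau\},\ \tau(1)\not\subseteq A\}$. *)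

(* Defs.v *)
From mathcomp Require Import all_boot all_order all_algebra.
From mathcomp Require Import classical_sets boolp functions cardinality fsbigop reals.
From mathcomp.multinomials Require Import mpoly.

Set Implicit Arguments.
Unset Strict Implicit.
Unset Printing Implicit Defensive.

Import Order.TTheory GRing.Theory Num.Theory.
Local Open Scope classical_set_scope.
Local Open Scope ring_scope.

(* R^n is 'rV[R]_n and its dual is 'cV[R]_n; the dual lattice Z^n is
   'cV[int]_n, embedded in the dual by intv.  Indices that are 1-based in the
   mathematics (variables, basis vectors, polygon vertices) are kept 1-based,
   as natural numbers. *)

Section PolyhedralGeometry.
Variables (R : realType) (n : nat).
Implicit Types (P : set 'rV[R]_n) (s t F : set 'cV[R]_n).
Implicit Types (Sigma : set (set 'cV[R]_n)) (u : 'cV[int]_n) (U : set 'cV[int]_n).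

Definition pairing (v : 'rV[R]_n) (w : 'cV[R]_n) : R := (v *m w) 0 0.

Definition convex_hull (X : set 'rV[R]_n) : set 'rV[R]_n :=
  [set x | exists (m : nat) (c : 'I_m -> R) (a : 'I_m -> 'rV[R]_n),
     [/\ forall i, 0 <= c i, \sum_i c i = 1, forall i, X (a i)
       & x = \sum_i c i *: a i]].

Definition minkowski_sum (A B : set 'rV[R]_n) : set 'rV[R]_n :=
  [set x + y | x in A & y in B].

Definition newton_polytope (p : {mpoly R[n]}) : set 'rV[R]_n :=
  convex_hull [set \row_i (m i)%:R | m in [set` msupp p]].

(* A vertex is a zero-dimensional face, exposed by a linear functional. *)
Definition vertex P (v : 'rV[R]_n) : Prop :=
  P v /\ exists w, forall v', P v' -> v' <> v -> pairing v w < pairing v' w.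

Definition normal_cone P (v : 'rV[R]_n) : set 'cV[R]_n :=
  [set w | forall v', P v' -> pairing v w <= pairing v' w].

Definition cone (X : set 'cV[R]_n) : set 'cV[R]_n :=
  [set x | exists (m : nat) (c : 'I_m -> R) (a : 'I_m -> 'cV[R]_n),
     [/\ forall i, 0 <= c i, forall i, X (a i) & x = \sum_i c i *: a i]].

Definition intv u : 'cV[R]_n := map_mx intr u.

Definition lcone U : set 'cV[R]_n := cone (intv @` U).

Definition face s F : Prop :=
  exists v, (forall w, s w -> 0 <= pairing v w) /\
            F = s `&` [set w | pairing v w = 0].

Definition inner_normal_fan P : set (set 'cV[R]_n) :=
  [set F | exists v, vertex P v /\ face (normal_cone P v) F].

Definition strongly_convex_rational s : Prop :=
  (exists U, finite_set U /\ s = lcone U) /\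
  (forall w, s w -> s (- w) -> w = 0).

Definition is_fan Sigma : Prop :=
  [/\ finite_set Sigma,
      forall s, Sigma s -> strongly_convex_rational s,
      forall s F, Sigma s -> face s F -> Sigma F
    & forall s t, Sigma s -> Sigma t ->
        face s (s `&` t) /\ face t (s `&` t)].

Definition maximal_cones Sigma : set (set 'cV[R]_n) :=
  [set s | Sigma s /\ forall t, Sigma t -> s `<=` t -> t = s].

Definition primitive u : Prop := (\big[gcdn/0]_i `|u i ord0|)%N = 1%N.

(* A ray is represented by its primitive generator. *)
Definition rays s : set 'cV[int]_n :=
  [set u | primitive u /\ face s (lcone [set u])].

Definition fan_rays Sigma : set 'cV[int]_n :=
  [set u | primitive u /\ Sigma (lcone [set u])].

Definition part_of_lattice_basis U : Prop :=
  exists B : 'M[int]_n, B \in unitmx /\ forall u, U u -> exists i, u = col i B.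

Definition smooth_cone s : Prop :=
  strongly_convex_rational s /\ part_of_lattice_basis (rays s).

Definition simplicial_cone s : Prop :=
  strongly_convex_rational s /\
  forall us : seq 'cV[int]_n, uniq us -> {in us, forall u, rays s u} ->
    free [seq intv u | u <- us].

Definition smooth_fan Sigma : Prop := forall s, Sigma s -> smooth_cone s.

Definition simplicial_fan Sigma : Prop := forall s, Sigma s -> simplicial_cone s.

Definition flag_fan Sigma : Prop :=
  forall U, U `<=` fan_rays Sigma ->
    (forall u u', U u -> U u' -> u <> u' -> Sigma (lcone [set u; u'])) ->
    Sigma (lcone U).

(* The vector u_tau; the sum is over a finite set when t is smooth. *)
Definition ray_sum t : 'cV[int]_n := \sum_(u \in rays t) u.

Definition star_subdivision t Sigma : set (set 'cV[R]_n) :=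
  [set s | Sigma s /\ ~ (t `<=` s)] `|`
  [set F | exists s A, [/\ Sigma s, t `<=` s, A `<=` rays s `|` [set ray_sum t],
                           ~ (rays t `<=` A) & F = lcone A]].

End PolyhedralGeometry.

Arguments intv R {n} u.
Arguments lcone R {n} U.

Section CatalanPellytope.
Variables (R : realType) (d n : nat).

(* The l-th summand is y_j y_(j+1) ... y_(j+l-1); it is 1 for l = 0.  The
   ordinal i stands for the variable y_(i+1). *)
Definition qpoly (k j : nat) : {mpoly R[n]} :=
  \sum_(0 <= l < k.+1)
    \prod_(i < n | (j <= i.+1 < j + l)%N) 'X_i.

Definition pellytope : set 'rV[R]_n :=
  \big[@minkowski_sum R n/[set 0]]_(1 <= k < d.+1)
    \big[@minkowski_sum R n/[set 0]]_(1 <= j < (n - k + 1).+1)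
      newton_polytope (qpoly k j).

Definition pelly_fan : set (set 'cV[R]_n) := inner_normal_fan pellytope.

End CatalanPellytope.

Arguments pellytope R d n : clear implicits.
Arguments pelly_fan R d n : clear implicits.

(* The chord joining the vertices a < b of the (n+3)-gon is the pair (a, b). *)
Definition chord : Type := (nat * nat)%type.

Definition dchord (d n : nat) : set chord :=
  [set c | [\/ [/\ c.1 = 1, 3 <= c.2 & c.2 <= n + 2],
               [/\ c.2 = n + 3, 2 <= c.1 & c.1 <= n + 1]
             | [/\ 2 <= c.1, c.1 < c.2, c.2 <= n + 2, 2 <= c.2 - c.1
                 & c.2 - c.1 <= d]]%N].

(* Diagonals of a convex polygon meet in its interior iff their endpoints
   alternate strictly in the cyclic order. *)
Definition crossing (c c' : chord) : bool :=
  ((c.1 < c'.1 < c.2) && (c.2 < c'.2) || (c'.1 < c.1 < c'.2) && (c'.2 < c.2))%N.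

(* c = (1, j) and c' = (i, n + 3) with 2 <= i < j <= n + 2 and j - i >= d + 1. *)
Definition far_pair (d n : nat) (c c' : chord) : bool :=
  [&& c.1 == 1, c'.2 == n + 3, 2 <= c'.1, c'.1 < c.2, c.2 <= n + 2
    & d + 1 <= c.2 - c'.1]%N.

Definition compatible (d n : nat) (c c' : chord) : bool :=
  [|| ~~ crossing c c', far_pair d n c c' | far_pair d n c' c].

Definition pairwise_compatible (d n : nat) (D : set chord) : Prop :=
  forall c c', D c -> D c' -> compatible d n c c'.

Definition admissible (d n : nat) : set (set chord) :=
  [set D | [/\ D `<=` dchord d n, pairwise_compatible d n D
             & forall D', D' `<=` dchord d n -> pairwise_compatible d n D' ->
                 D `<=` D' -> D' = D]].

Definition basis_vec (n k : nat) : 'cV[int]_n := \col_i (i.+1 == k)%:R.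

Definition chord_vec (n : nat) (c : chord) : 'cV[int]_n :=
  if c.1 == 1%N then - basis_vec n (c.2 - 2)
  else if c.2 == (n + 3)%N then basis_vec n (c.1 - 1)
  else basis_vec n (c.1 - 1) - basis_vec n (c.2 - 2).

Definition chord_cone (R : realType) (n : nat) (D : set chord) : set 'cV[R]_n :=
  lcone R (chord_vec n @` D).

Arguments chord_cone R n D : clear implicits.

Definition chord_fan (R : realType) (d n : nat) : set (set 'cV[R]_n) :=
  [set F | exists D, admissible d n D /\ face (chord_cone R n D) F].

Arguments chord_fan R d n : clear implicits.

(* For c = (i, j): the cone spanned by the rays of (1, j) and (i, n + 3). *)
Definition crossing_cone (R : realType) (n : nat) (c : chord) : set 'cV[R]_n :=
  chord_cone R n [set (1%N, c.2); (c.1, (n + 3)%N)].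

Arguments crossing_cone R n c : clear implicits.

Definition star_subdivisions (R : realType) (n : nat)
    (Sigma : set (set 'cV[R]_n)) (cs : seq chord) : set (set 'cV[R]_n) :=
  foldl (fun F c => star_subdivision (crossing_cone R n c) F) Sigma cs.

(* Main.v *)
Require Import Defs.
From mathcomp Require Import all_boot all_order all_algebra.
From mathcomp Require Import classical_sets boolp functions cardinality fsbigop reals.
From mathcomp Require Import zify ring lra.
From mathcomp.multinomials Require Import mpoly.

Set Implicit Arguments.
Unset Strict Implicit.
Unset Printing Implicit Defensive.

Import Order.TTheory GRing.Theory Num.Theory.
Local Open Scope classical_set_scope.
Local Open Scope ring_scope.

(** Fix a list of labelled integer vectors and a symmetric compatibility
    relation.  Suppose that every clique of compatible labels extends to one
    whose vectors form a lattice basis, and that every real vector is a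
    nonnegative combination of the vectors of a clique in exactly one way.
    Then the cones over cliques form a complete smooth flag fan whose rays are
    the labels and whose maximal cones are the maximal cliques
    ([unimodular_system] and its consequences).

    This structure is preserved by star subdivision along a compatible edge
    [p q]: the new label [r], with vector the sum of those of [p] and [q], is
    compatible with what was compatible with both ends, and representations
    are transported by moving the smaller of the two coefficients to [r]
    ([subdivision_system], [star_subdivisionE]).  For chords of level 1 the
    structure is the decomposition of a vector into positive and negative
    parts ([unit_system]).  Inserting the diagonals of length [d] one at a time
    turns the level [d - 1] relation into the level [d] relation
    ([stage_edge], [stage_system]), which proves by induction that compatible
    [d]-chords form such a structure and gives the sequence of subdivisions.

    To identify this fan with the normal fan of a polytope it suffices that the
    vectors of each clique have a common minimizer on the polytope, and that
    those of two incompatible labels have none ([inner_normal_fanE]).  For a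
    Minkowski sum both conditions are tested on the summands.  In terms of
    partial sums, a chord is the indicator function of an interval of
    {0, ..., n}, a summand is a window of at most [d + 1] consecutive points,
    and minimizing means choosing a point of the window with the least value.
    A clique admits a point of the window that avoids all its intervals not
    containing the window ([window_min]), whereas two incompatible intervals
    jointly cover some window that neither contains ([window_incompatible]). *)

(** * Lattice vectors *)

Section Pairing.
Variables (R : realType) (n : nat).
Implicit Types (v : 'rV[R]_n) (w : 'cV[R]_n).

Lemma pairingE v w : pairing v w = \sum_i v 0 i * w i 0.
Proof. by rewrite /pairing mxE. Qed.

Lemma pairingDl v v' w : pairing (v + v') w = pairing v w + pairing v' w.
Proof. by rewrite /pairing mulmxDl mxE. Qed.

Lemma pairingZr v a w : pairing v (a *: w) = a * pairing v w.
Proof. by rewrite /pairing -scalemxAr mxE. Qed.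

Lemma pairingZl v a w : pairing (a *: v) w = a * pairing v w.
Proof. by rewrite /pairing -scalemxAl mxE. Qed.

Lemma pairing_sumr (I : Type) (s : seq I) (P : pred I) v (F : I -> 'cV[R]_n) :
  pairing v (\sum_(i <- s | P i) F i) = \sum_(i <- s | P i) pairing v (F i).
Proof. by rewrite /pairing mulmx_sumr summxE. Qed.

Lemma pairing_suml (I : Type) (s : seq I) (P : pred I) (F : I -> 'rV[R]_n) w :
  pairing (\sum_(i <- s | P i) F i) w = \sum_(i <- s | P i) pairing (F i) w.
Proof. by rewrite /pairing mulmx_suml summxE. Qed.

End Pairing.

Section LatticeVectors.
Variables (R : realType) (n : nat).
Implicit Types (w : 'cV[R]_n).

Lemma intvD (u u' : 'cV[int]_n) : intv R (u + u') = intv R u + intv R u'.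
Proof. by rewrite /intv map_mxD. Qed.

Lemma intv_inj : injective (@intv R n).
Proof.
move=> u u' /matrixP e; apply/matrixP => i j.
by have := e i j; rewrite !mxE => /intr_inj.
Qed.

Lemma primitive_eq0 (u : 'cV[int]_n) : primitive u -> u <> 0.
Proof.
move=> + u0; rewrite /primitive u0 big1// => i _; first by rewrite mxE.
Qed.

(** Cross-multiplying by a nonzero entry and taking greatest common divisors
    of all entries shows that the two vectors agree up to sign. *)
Lemma primitive_ray (u u' : 'cV[int]_n) (x : R) : primitive u -> primitive u' ->
  0 <= x -> intv R u = x *: intv R u' -> u = u'.
Proof.
move=> pu pu' x0 e.
have eE i : (u i 0)%:~R = x * (u' i 0)%:~R by have /matrixP/(_ i 0) := e; rewrite !mxE.
have [k uk'] : exists k, u' k 0 != 0.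
  apply: contrapT => /forallNP u0; apply: (primitive_eq0 pu').
  apply/matrixP => i j; rewrite ord1 [RHS]mxE.
  by apply/eqP; have /negP := u0 i; rewrite negbK.
have cross i : u i 0 * u' k 0 = u k 0 * u' i 0.
  by apply: (@intr_inj R); rewrite !rmorphM/= !eE; ring.
have gcdM (m : nat) (a : 'I_n -> nat) :
    (\big[gcdn/0]_i (m * a i) = m * \big[gcdn/0]_i a i)%N.
  by rewrite (big_morph (muln m) (muln_gcdr m) (muln0 m)).
have absk : `|u' k ord0|%N = `|u k ord0|%N.
  transitivity (`|u' k ord0| * \big[gcdn/0]_i `|u i ord0|)%N.
    by rewrite [X in (_ * X)%N]pu muln1.
  transitivity (`|u k ord0| * \big[gcdn/0]_i `|u' i ord0|)%N; last first.
    by rewrite [X in (_ * X)%N]pu' muln1.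
  rewrite -!gcdM.
  by apply: eq_bigr => i _; rewrite -!abszM mulrC [in LHS]cross.
have x1 : x = 1.
  have uk'R : (u' k 0)%:~R != 0 :> R by rewrite intr_eq0.
  have : `|(u k 0)%:~R : R| = `|(u' k 0)%:~R|.
    by rewrite -!intr_norm; congr (_%:~R); rewrite -!abszE; congr Posz.
  rewrite eE normrM (ger0_norm x0) -[RHS]mul1r => /mulIf; apply.
  by rewrite normr_eq0.
by apply: intv_inj; rewrite e x1 scale1r.
Qed.

Lemma lcone1P (u : 'cV[int]_n) w : lcone R [set u] w ->
  exists2 x, 0 <= x & w = x *: intv R u.
Proof.
move=> [m [c [a [c0 aA ->]]]]; exists (\sum_i c i); first exact: sumr_ge0.
rewrite scaler_suml; apply: eq_bigr => i _.
by have [_ -> <-] := aA i.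
Qed.

Lemma lcone1_gen (u : 'cV[int]_n) : lcone R [set u] (intv R u).
Proof.
exists 1%N, (fun=> 1), (fun=> intv R u); split=> //; first by move=> _; exists u.
by rewrite big_ord1 scale1r.
Qed.

End LatticeVectors.

(** * Cliques of labelled rays *)

Section CliqueFan.
Variables (R : realType) (n : nat) (T : eqType) (V : T -> 'cV[int]_n).
Implicit Types (G : seq T) (K : rel T) (A B : set T) (f g : T -> R).
Implicit Types (w : 'cV[R]_n) (D : 'I_n -> T).

(** The elements of [G] label rays through the vectors [V c], and [K] says
    which labels may occur together. *)
Definition clique G K A : Prop :=
  A `<=` [set` G] /\ forall c c', A c -> A c' -> K c c'.

Definition label_cone A : set 'cV[R]_n := lcone R (V @` A).

Definition clique_fan G K : set (set 'cV[R]_n) :=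
  [set label_cone A | A in clique G K].

Definition comb G f : 'cV[R]_n := \sum_(c <- G) f c *: intv R (V c).

Definition supp f : set T := [set c | f c != 0].

Definition represents G K f w : Prop :=
  [/\ forall c, 0 <= f c, clique G K (supp f) & w = comb G f].

Definition column_matrix D : 'M[int]_n := \matrix_(i, j) V (D j) i 0.

Definition basis_clique G K D : Prop :=
  [/\ forall i, D i \in G, forall i j, K (D i) (D j)
    & column_matrix D \in unitmx].

(** A combinatorial presentation of a complete smooth fan: [us_ex] says that
    the cones over cliques cover the space, [us_unique] that they meet only
    along common faces, and [us_basis] that every clique lies in one whose
    vectors form a lattice basis.  Since cones are described by pairwise
    conditions, such a fan is flag by construction. *)
Record unimodular_system G K : Prop := UnimodularSystem {
  us_uniq : uniq G;
  us_refl : forall c, c \in G -> K c c;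
  us_sym : forall c c', c \in G -> c' \in G -> K c c' = K c' c;
  us_basis : forall A, clique G K A ->
    exists D, basis_clique G K D /\ A `<=` range D;
  us_ex : forall w, exists f, represents G K f w;
  us_unique : forall f g w, represents G K f w -> represents G K g w -> f = g
}.

Lemma cliqueS G K A B : A `<=` B -> clique G K B -> clique G K A.
Proof.
by move=> AB [BG BK]; split=> [|c c' /AB Bc /AB Bc']; [exact: subset_trans BG|exact: BK].
Qed.

Lemma sum_delta G (t : T) (x : R) (F : T -> 'cV[R]_n) : uniq G -> t \in G ->
  \sum_(c <- G) (x * (t == c)%:R) *: F c = x *: F t.
Proof.
move=> uG tG; rewrite (bigD1_seq t)//= eqxx mulr1 big1 ?addr0// => c ct.
by rewrite eq_sym (negbTE ct) mulr0 scale0r.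
Qed.

Lemma label_coneP G A w : uniq G -> A `<=` [set` G] ->
  label_cone A w <->
  exists f, [/\ forall c, 0 <= f c, supp f `<=` A & w = comb G f].
Proof.
move=> uG AG; split.
  move=> [m [c [a [c0 aA ->]]]].
  have {aA} /choice[b bP] : forall i, exists t, A t /\ intv R (V t) = a i.
    by move=> i; have [_ [t At <-] <-] := aA i; exists t.
  exists (fun t => \sum_i c i * (b i == t)%:R); split.
  - by move=> t; apply: sumr_ge0 => i _; rewrite mulr_ge0.
  - move=> t /= /negP tP; apply: contrapT => nAt; apply: tP.
    apply/eqP; rewrite big1// => i _; case: eqP => [bt|]; last by rewrite mulr0.
    by case: nAt; rewrite -bt; case: (bP i).
  - rewrite /comb; under [RHS]eq_bigr do rewrite scaler_suml.
    rewrite exchange_big /=; apply: eq_bigr => i _.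
    have [Ab <-] := bP i.
    by rewrite (sum_delta (c i) (fun t => intv R (V t)))//; apply: AG.
move=> [f [f0 fA ->]].
have -> : comb G f = \sum_(c <- [seq c <- G | f c != 0]) f c *: intv R (V c).
  rewrite big_filter [RHS]big_mkcond; apply: eq_bigr => c _.
  by case: eqP => //= ->; rewrite scale0r.
rewrite big_tnth.
set s := in_tuple _.
exists (size [seq c <- G | f c != 0]), (fun i => f (tnth s i)),
  (fun i => intv R (V (tnth s i))); split=> // i.
have : tnth s i \in s by exact: mem_tnth.
rewrite mem_filter => /andP[fi _].
by exists (V (tnth s i)) => //; exists (tnth s i) => //; apply: fA.
Qed.

Lemma pairing_comb v G f :
  pairing v (comb G f) = \sum_(c <- G) f c * pairing v (intv R (V c)).
Proof. by rewrite pairing_sumr; apply: eq_bigr => c _; rewrite pairingZr. Qed.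

Lemma combD G f g : comb G (fun c => f c + g c) = comb G f + comb G g.
Proof. by rewrite -big_split; apply: eq_bigr => c _; rewrite scalerDl. Qed.

Lemma comb_delta G c x : uniq G -> c \in G ->
  comb G (fun t => x * (c == t)%:R) = x *: intv R (V c).
Proof. exact: (sum_delta x (fun t => intv R (V t))). Qed.

(** The rows of the inverse matrix are the dual basis, so a functional may be
    prescribed freely on the vectors of a unimodular matrix. *)
Lemma dual_basis D (chi : 'I_n -> R) : column_matrix D \in unitmx ->
  exists v, forall i, pairing v (intv R (V (D i))) = chi i.
Proof.
move=> uD.
exists ((\row_i chi i) *m map_mx intr (invmx (column_matrix D))) => i.
have -> : V (D i) = col i (column_matrix D).
  by apply/matrixP => k l; rewrite !mxE ord1.
rewrite /pairing /intv map_col colE mulmxA -(mulmxA (\row_ _ _)) -map_mxM.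
by rewrite mulVmx// map_mx1 mulmx1 -colE !mxE.
Qed.

Lemma basis_inj D : column_matrix D \in unitmx -> injective D.
Proof.
move=> uD i j Dij; have [v vP] := dual_basis (fun k => (k == i)%:R) uD.
have := vP i; rewrite Dij vP eqxx; case: eqP => //= _ /eqP.
by rewrite eq_sym oner_eq0.
Qed.

(** A column of an invertible integer matrix pairs to 1 with a row of the
    inverse, so a common divisor of its entries divides 1. *)
Lemma primitive_basis D i : column_matrix D \in unitmx -> primitive (V (D i)).
Proof.
move=> uD; rewrite /primitive.
set g := (X in X = _).
have gP k : (g %| V (D i) k ord0)%Z by apply: (biggcdn_inf k).
suff : (g %| (invmx (column_matrix D) *m column_matrix D) i i)%Z.
  by rewrite mulVmx// mxE eqxx dvdz1 => /eqP.
rewrite mxE; elim/big_ind: _ => [|x y|k _].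
  - exact: dvdz0.
  - exact: rpredD.
  - by apply: dvdz_mull; rewrite mxE.
Qed.

End CliqueFan.

Arguments label_cone R {n T} V A _.
Arguments clique_fan R {n T} V G K _.

(** * The fan of a unimodular system *)

Section UnimodularFan.
Variables (R : realType) (n : nat) (T : eqType) (V : T -> 'cV[int]_n).
Variables (G : seq T) (K : rel T).
Hypothesis GK : unimodular_system R V G K.
Implicit Types (A B : set T) (f g : T -> R).
Implicit Types (w : 'cV[R]_n) (D : 'I_n -> T).

Local Notation C := (label_cone R V).
Local Notation Sigma := (clique_fan R V G K).

Lemma clique_coneP A w : clique G K A ->
  C A w <-> exists2 f, represents V G K f w & supp f `<=` A.
Proof.
move=> cA; rewrite label_coneP; [|exact: us_uniq GK|by case: cA].
split=> [[f [f0 fA ->]]|[f [f0 _ ->] fA]]; exists f => //.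
by split=> //; exact: cliqueS cA.
Qed.

Lemma clique1 c : c \in G -> clique G K [set c].
Proof.
by move=> cG; split=> [t ->//|t t' -> ->]; exact: us_refl GK _ cG.
Qed.

Lemma represents_ray c : c \in G ->
  represents V G K (fun t => (c == t)%:R : R) (intv R (V c)).
Proof.
move=> cG; split=> [t||]; first exact: ler0n.
- by apply: cliqueS (clique1 cG) => t; rewrite /supp/= pnatr_eq0 eqb0 negbK => /eqP ->.
- have := comb_delta V (1 : R) (us_uniq GK) cG; rewrite scale1r => <-.
  by apply: eq_bigr => t _; rewrite mul1r.
Qed.

Lemma cone_gen A c : A c -> C A (intv R (V c)).
Proof.
move=> Ac; exists 1%N, (fun=> 1), (fun=> intv R (V c)); split=> //.
  by move=> _; exists (V c) => //; exists c.
by rewrite big_ord1 scale1r.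
Qed.

(** The generator of a ray has itself as its unique representation, which must
    therefore be the one supplied by any cone that contains it. *)
Lemma cone_genE A c : clique G K A -> c \in G -> C A (intv R (V c)) -> A c.
Proof.
move=> cA cG /(clique_coneP _ cA)[f fr fA]; apply: fA.
have -> := us_unique GK fr (represents_ray cG).
by rewrite /supp/= eqxx oner_eq0.
Qed.

Lemma cone_sub A B : A `<=` [set` G] -> clique G K B -> C A `<=` C B -> A `<=` B.
Proof. by move=> AG cB AB c Ac; apply: cone_genE => //; [exact: AG|exact/AB/cone_gen]. Qed.

Lemma coneS A B : A `<=` B -> C A `<=` C B.
Proof.
move=> AB w [m [c [a [c0 aA ->]]]]; exists m, c, a; split=> // i.
by have [_ [t At <-] <-] := aA i; exists (V t) => //; exists t => //; exact: AB.
Qed.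

Lemma cone_inj A B : clique G K A -> clique G K B -> C A = C B -> A = B.
Proof.
move=> cA cB AB; apply/seteqP; split; apply: cone_sub => //.
- by case: cA.
- by rewrite AB.
- by case: cB.
- by rewrite AB.
Qed.

(** By uniqueness, a vector of both cones has a single representation, whose
    support lies in both cliques. *)
Lemma coneI A B : clique G K A -> clique G K B -> C A `&` C B = C (A `&` B).
Proof.
move=> cA cB; apply/seteqP; split=> [w|w wAB]; last first.
  by split; apply: coneS wAB => t [].
move=> [/(clique_coneP _ cA)[f fr fA] /(clique_coneP _ cB)[g gr gB]].
apply/clique_coneP; first exact: cliqueS cA.
exists f => //; rewrite subsetI; split => //.
by rewrite (us_unique GK fr gr).
Qed.

(** Completing the clique to a lattice basis gives a functional that is 0 on
    [B] and 1 on the rest of [A]; it exposes the cone over [B] as a face. *)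
Lemma separating_row A B : clique G K A -> B `<=` A ->
  exists v, forall c, A c -> pairing v (intv R (V c)) = (~~ `[< B c >])%:R.
Proof.
move=> cA BA; have [D [[_ _ uD] AD]] := us_basis GK cA.
have [v vP] := dual_basis (fun i => (~~ `[< B (D i) >])%:R : R) uD.
by exists v => c /AD[i _ <-]; rewrite vP.
Qed.

Lemma face_cone A F : clique G K A ->
  face (C A) F <-> exists2 B, B `<=` A & F = C B.
Proof.
move=> cA; split.
  move=> [v [v0 ->]].
  pose B := A `&` [set c | pairing v (intv R (V c)) = 0].
  have BA : B `<=` A by exact: subIsetl.
  have cB := cliqueS BA cA.
  exists B => //; apply/seteqP; split=> w.
    move=> [/(clique_coneP _ cA)[f fr fA] vw]; apply/clique_coneP => //.
    exists f => // c fc; split; first exact: fA.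
    have [f0 _ wE] := fr; move: vw; rewrite /= wE pairing_comb => /eqP.
    rewrite psumr_eq0 => [/allP/(_ c)|c' _].
      have /= -> : c \in G by case: cA => AG _; exact/AG/fA.
      by move=> /(_ isT); rewrite mulf_eq0 (negbTE fc) => /eqP.
    have [->|fc'] := eqVneq (f c') 0; first by rewrite mul0r.
    by rewrite mulr_ge0// v0//; exact/cone_gen/fA.
  move=> wB; split; first exact: coneS wB.
  have /(clique_coneP _ cB)[f [f0 _ ->] fB] := wB.
  rewrite /= pairing_comb big1// => c _.
  have [->|/fB[_ ->]] := eqVneq (f c) 0; first by rewrite mul0r.
  by rewrite mulr0.
move=> [B BA ->]; have [v vP] := separating_row cA BA.
have cB := cliqueS BA cA.
exists v; split.
  move=> w /(clique_coneP _ cA)[f [f0 _ ->] fA]; rewrite pairing_comb.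
  apply: sumr_ge0 => c _.
  have [->|/fA/vP->] := eqVneq (f c) 0; first by rewrite mul0r.
  by rewrite mulr_ge0// ler0n.
apply/seteqP; split=> w.
  move=> wB; split; first exact: coneS wB.
  have /(clique_coneP _ cB)[f [f0 _ ->] fB] := wB.
  rewrite /= pairing_comb big1// => c _.
  have [->|/fB Bc] := eqVneq (f c) 0; first by rewrite mul0r.
  by rewrite vP ?asboolT ?mulr0//; exact: BA.
move=> [/(clique_coneP _ cA)[f fr fA] vw]; apply/clique_coneP => //.
exists f => // c fc; have [f0 _ wE] := fr; move: vw; rewrite /= wE pairing_comb => /eqP.
rewrite psumr_eq0 => [/allP/(_ c)|c' _].
  have /= -> : c \in G by case: cA => AG _; exact/AG/fA.
  move=> /(_ isT); rewrite mulf_eq0 (negbTE fc) vP /=; last exact: fA.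
  by case: asboolP => // _; rewrite oner_eq0.
have [->|/fA/vP->] := eqVneq (f c') 0; first by rewrite mul0r.
by rewrite mulr_ge0// ler0n.
Qed.

Lemma label_cone_fan A : A `<=` [set` G] -> Sigma (C A) <-> clique G K A.
Proof.
move=> AG; split=> [[B cB BA]|cA]; last by exists A.
by apply: (cliqueS _ cB); apply: cone_sub => //; rewrite BA.
Qed.

Lemma clique_finite A : clique G K A -> finite_set A.
Proof. by case=> AG _; apply: sub_finite_set AG _; exact: finite_seq. Qed.

Lemma clique_cone_scr A : clique G K A -> strongly_convex_rational (C A).
Proof.
move=> cA; split.
  exists (V @` A); split=> //; exact/finite_image/clique_finite.
move=> w /(clique_coneP _ cA)[f [f0 _ wf] fA] /(clique_coneP _ cA)[g [g0 _ wg] gA].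
have r0 : represents V G K (fun=> 0 : R) 0.
  split=> //; first by split=> [c|c c'] /eqP.
  by rewrite /comb big1// => c _; rewrite scale0r.
have rfg : represents V G K (fun c => f c + g c) 0.
  split; first by move=> c; rewrite addr_ge0.
    apply: cliqueS cA => c /=; rewrite /supp/= => fg.
    have [fc|/fA//] := eqVneq (f c) 0; apply: gA => /=.
    by move: fg; rewrite fc add0r.
  by rewrite combD -wf -wg subrr.
have fg := us_unique GK rfg r0.
rewrite wf /comb big1// => c _.
have /eqP := congr1 (fun h => h c) fg; rewrite /= paddr_eq0// => /andP[/eqP-> _].
by rewrite scale0r.
Qed.

Lemma clique_fan_finite : finite_set Sigma.
Proof.
apply: finite_image; apply: (@sub_finite_set _ _ ((fun m : (size G).-tuple bool => [set` mask m G]) @` setT)).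
  move=> A [AG _]; exists (map_tuple (fun c => `[< A c >]) (in_tuple G)) => //=.
  apply/seteqP; split=> c; rewrite /= -filter_mask mem_filter.
    by move=> /andP[/asboolP].
  by move=> Ac; rewrite asboolT//=; exact: AG.
exact/finite_image/finite_finset.
Qed.

Lemma clique_fan_is_fan : is_fan Sigma.
Proof.
split.
- exact: clique_fan_finite.
- by move=> _ [A cA <-]; exact: clique_cone_scr.
- move=> _ F [A cA <-] /(face_cone _ cA)[B BA ->].
  by exists B => //; exact: cliqueS cA.
- move=> _ _ [A cA <-] [B cB <-]; rewrite coneI//.
  by split; apply/face_cone => //; exists (A `&` B) => // c [].
Qed.

Lemma primitive_label c : c \in G -> primitive (V c).
Proof.
move=> cG; have [D [[_ _ uD] /(_ c)]] := us_basis GK (clique1 cG).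
by case=> // i _ <-; exact: (primitive_basis _ uD).
Qed.

Lemma label_inj : {in G &, injective V}.
Proof.
move=> c c' cG c'G e; have rc' := represents_ray c'G.
have := us_unique GK (represents_ray cG); rewrite e => /(_ _ rc') fg.
have := congr1 (fun h => h c) fg; rewrite /= eqxx; case: eqP => //= _ /eqP.
by rewrite oner_eq0.
Qed.

Lemma primitive_cone_label (u : 'cV[int]_n) A : clique G K A ->
  primitive u -> lcone R [set u] = C A -> (V @` A) u.
Proof.
move=> cA pu uA.
have [c Ac] : exists c, A c.
  apply: contrapT => /forallNP A0; apply: (primitive_eq0 pu).
  have : C A (intv R u) by rewrite -uA; exact: lcone1_gen.
  move=> /(clique_coneP _ cA)[f [_ _ uf] fA].
  apply: (@intv_inj R); rewrite uf /comb /intv map_mx0 big1// => c _.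
  by have [->|/fA/A0//] := eqVneq (f c) 0; rewrite scale0r.
exists c => //.
have : C A (intv R (V c)) by exact: cone_gen.
rewrite -uA => /lcone1P[x x0]; apply: primitive_ray => //.
by apply: primitive_label; case: cA => AG _; exact: AG.
Qed.

Lemma label_cone1 c : C [set c] = lcone R [set V c].
Proof. by rewrite /label_cone image_set1. Qed.

Lemma rays_label_cone A : clique G K A -> rays (C A) = V @` A.
Proof.
move=> cA; apply/seteqP; split=> u.
  move=> [pu /(face_cone _ cA)[B BA uB]].
  have := primitive_cone_label (cliqueS BA cA) pu uB.
  by move=> [c Bc <-]; exists c => //; exact: BA.
move=> [c Ac <-]; split.
  by apply: primitive_label; case: cA => AG _; exact: AG.
by apply/face_cone => //; exists [set c]; [move=> _ ->|rewrite label_cone1].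
Qed.

Lemma fan_rays_clique_fan : fan_rays Sigma = V @` [set` G].
Proof.
apply/seteqP; split=> u.
  move=> [pu [A cA /esym uA]].
  have [c Ac <-] := primitive_cone_label cA pu uA.
  by exists c => //; case: cA => AG _; exact: AG.
move=> [c cG <-]; split; first exact: primitive_label.
by exists [set c]; [exact: clique1|rewrite label_cone1].
Qed.

Lemma clique_cone_smooth A : clique G K A -> smooth_cone (C A).
Proof.
move=> cA; split; first exact: clique_cone_scr.
rewrite rays_label_cone//; have [D [[_ _ uD] AD]] := us_basis GK cA.
exists (column_matrix V D); split=> // _ [c /AD[i _ <-] <-]; exists i.
by apply/matrixP => k l; rewrite !mxE ord1.
Qed.

Lemma clique_cone_simplicial A : clique G K A -> simplicial_cone (C A).
Proof.
move=> cA; split; first exact: clique_cone_scr.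
rewrite rays_label_cone// => us uus usA.
have [D [[_ _ uD] AD]] := us_basis GK cA.
apply/(@freeP _ _ _ (in_tuple [seq intv R u | u <- us])) => k k0 i.
have isz : (i < size us)%N by rewrite -(size_map (intv R) us) ltn_ord.
have [c Ac cE] := usA _ (mem_nth 0 isz).
have [j _ Dj] := AD _ Ac.
have [v vP] := dual_basis (fun l => (l == j)%:R : R) uD.
have := congr1 (pairing v) k0; rewrite pairing_sumr (bigD1 i)//= big1 ?addr0.
  rewrite pairingZr (nth_map 0)// -cE -Dj vP eqxx mulr1 => ->.
  by rewrite /pairing mulmx0 mxE.
move=> i' i'i; rewrite pairingZr.
have isz' : (i' < size us)%N by rewrite -(size_map (intv R) us) ltn_ord.
have [c' Ac' cE'] := usA _ (mem_nth 0 isz').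
have [j' _ Dj'] := AD _ Ac'.
rewrite (nth_map 0)// -cE' -Dj' vP; case: eqP => [j'j|]; last by rewrite mulr0.
case/negP: i'i; rewrite -val_eqE -(nth_uniq 0 isz' isz uus).
by rewrite -cE -cE' -Dj -Dj' j'j.
Qed.

(** Distinct labels have distinct vectors, and two of them span a cone exactly
    when they are compatible; so the hypothesis on pairs makes a clique. *)
Lemma clique_fan_flag : flag_fan Sigma.
Proof.
move=> U; rewrite fan_rays_clique_fan => UG pairs.
pose A := [set c | c \in G /\ U (V c)].
have AG : A `<=` [set` G] by move=> c [].
have UA : U = V @` A.
  apply/seteqP; split=> [u Uu|_ [c [_ Uc] <-]//].
  by have [c cG cu] := UG _ Uu; exists c => //; split=> //; rewrite cu.
rewrite UA; apply/label_cone_fan => //; split=> // c c' [cG Uc] [c'G Uc'].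
have [->|cc'] := eqVneq c c'; first exact: us_refl GK _ c'G.
have := pairs _ _ Uc Uc'; case=> [e|A' cA' A'E].
  by move/eqP: cc'; apply; apply: label_inj.
have : Sigma (C [set c; c']).
  exists A' => //; rewrite A'E /label_cone; congr lcone.
  by rewrite image_setU !image_set1.
rewrite label_cone_fan; last by move=> _ [->|->].
by case=> _; apply; [left|right].
Qed.

Lemma basis_clique_clique D : basis_clique V G K D -> clique G K (range D).
Proof. by move=> [DG DK _]; split=> [_ [i _ <-]|_ _ [i _ <-] [j _ <-]]; [exact: DG|exact: DK]. Qed.

(** A clique that contains [D] is itself contained in a basis clique, and an
    injection between two families of [n] labels is onto. *)
Lemma basis_clique_maximal D A : basis_clique V G K D -> clique G K A ->
  range D `<=` A -> A = range D.
Proof.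
move=> [DG DK uD] cA DA; apply/seteqP; split=> // c Ac.
have [D' [[_ _ uD'] AD']] := us_basis GK cA.
have /choice[s sP] : forall i, exists j, D' j = D i.
  by move=> i; have [|j _ <-] := AD' (D i); [apply: DA; exists i|exists j].
have sI : injective s.
  by move=> i j ij; apply: (basis_inj R uD); rewrite -!sP ij.
have [j _ <-] := AD' _ Ac.
by exists (invF sI j) => //; rewrite -sP f_invF.
Qed.

Definition maximal_clique A : Prop :=
  clique G K A /\ forall B, clique G K B -> A `<=` B -> B = A.

Lemma maximal_cliqueP A :
  maximal_clique A <-> exists2 D, basis_clique V G K D & A = range D.
Proof.
split=> [[cA maxA]|[D bD ->]].
  have [D [bD AD]] := us_basis GK cA; exists D => //.
  by rewrite (maxA _ (basis_clique_clique bD) AD).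
split; first exact: basis_clique_clique.
by move=> B cB; exact: basis_clique_maximal.
Qed.

Lemma maximal_cones_bij : set_bij maximal_clique (maximal_cones Sigma) C.
Proof.
split.
- move=> A [cA maxA]; split; first by exists A.
  move=> _ [B cB <-] AB; congr C; apply: maxA => //.
  by apply: cone_sub => //; case: cA.
- by move=> A B; rewrite !inE => -[cA _] [cB _]; exact: cone_inj.
- move=> _ [[A cA <-] maxA]; exists A => //; split=> // B cB AB.
  by apply: cone_inj => //; apply: maxA; [exists B|exact: coneS].
Qed.

(** Every clique extends to a maximal one, so the fan consists of the faces of
    the maximal cones, as normal fans and chord diagram fans are defined. *)
Lemma clique_fanE :
  Sigma = [set F | exists A, maximal_clique A /\ face (C A) F].
Proof.
apply/seteqP; split=> [_ [A cA <-]|F [A [[cA _] /(face_cone _ cA)[B BA ->]]]].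
  have [D [bD AD]] := us_basis GK cA; exists (range D); split.
    by apply/maximal_cliqueP; exists D.
  by apply/face_cone; [exact: basis_clique_clique|exists A].
by exists B => //; exact: cliqueS cA.
Qed.

End UnimodularFan.

(** * Star subdivision along an edge *)

Section EdgeSubdivision.
Variables (R : realType) (n : nat) (T : eqType) (V : T -> 'cV[int]_n).
Implicit Types (G : seq T) (K : rel T) (p q r c : T) (A B : set T).
Implicit Types (f g : T -> R) (w : 'cV[R]_n).

(** Inserting the new ray [r] on the edge [p q]: the edge disappears, and [r] is
    compatible with the link of the edge, including [p] and [q]. *)
Record edge_subdivision G K p q r K' : Prop := EdgeSubdivision {
  es_system : unimodular_system R V G K;
  es_p : p \in G;
  es_q : q \in G;
  es_neq : p != q;
  es_edge : K p q;
  es_new : r \notin G;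
  es_sum : V r = V p + V q;
  es_old : forall x y, x \in G -> y \in G ->
    K' x y = K x y && ~~ ((x == p) && (y == q) || (x == q) && (y == p));
  es_link : forall x, x \in G -> K' r x = K p x && K q x;
  es_linkC : forall x, x \in G -> K' x r = K' r x;
  es_loop : K' r r
}.

Lemma edge_subdivisionC G K p q r K' :
  edge_subdivision G K p q r K' -> edge_subdivision G K q p r K'.
Proof.
case=> GK pG qG pq Kpq rG Vr old link linkC loop; split=> //.
- by rewrite eq_sym.
- by rewrite (us_sym GK).
- by rewrite addrC.
- by move=> x y xG yG; rewrite old// orbC.
- by move=> x xG; rewrite link// andbC.
Qed.

Section Cliques.
Variables (G : seq T) (K : rel T) (p q r : T) (K' : rel T).
Hypothesis S : edge_subdivision G K p q r K'.

Let GK := es_system S.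

Lemma subdivided_edge : K' p q = false.
Proof. by rewrite (es_old S) ?(es_p S) ?(es_q S)// !eqxx andbF. Qed.

Lemma subdivided_old x y : x \in G -> y \in G -> K' x y -> K x y.
Proof. by move=> xG yG; rewrite (es_old S)// => /andP[]. Qed.

Lemma clique_keep A : clique G K A -> ~ (A p /\ A q) -> clique (r :: G) K' A.
Proof.
move=> [AG AK] npq; split=> [c /AG cG|x y Ax Ay]; first by rewrite /= inE; apply/orP; right.
rewrite (es_old S) ?AK//=; [|exact: AG|exact: AG].
by apply/negP => /orP[|] /andP[/eqP xp /eqP yq]; apply: npq; rewrite -xp -yq.
Qed.

Lemma clique_old A : clique (r :: G) K' A -> clique G K (A `&` [set` G]).
Proof.
by move=> [_ AK]; split=> [c []//|x y [Ax xG] [Ay yG]]; apply: subdivided_old => //; exact: AK.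
Qed.

Lemma clique_not_edge A : clique (r :: G) K' A -> ~ (A p /\ A q).
Proof. by move=> [_ AK] [Ap Aq]; have := AK _ _ Ap Aq; rewrite subdivided_edge. Qed.

(** A clique through the new ray lies in the closed star of the old edge. *)
Lemma clique_join A : clique (r :: G) K' A -> A r ->
  clique G K ((A `&` [set` G]) `|` [set p; q]).
Proof.
move=> cA Ar; have [_ AK] := cA; have [_ oK] := clique_old cA.
have [pG qG] := (es_p S, es_q S).
have lk x : x \in G -> A x -> K p x /\ K q x.
  by move=> xG Ax; have := AK _ _ Ar Ax; rewrite (es_link S)// => /andP[].
split=> [c [[]//|[->|->]]//|x y].
move=> [[Ax xG]|[->|->]] [[Ay yG]|[->|->]]; do ?[by case: (lk y)];
  do ?[by rewrite (us_sym GK)//; case: (lk x)]; do ?[exact: us_refl GK _ _].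
- by apply: oK.
- exact: es_edge S.
- by rewrite (us_sym GK)//; exact: es_edge S.
Qed.

(** Replacing the column of [p] by the sum of the columns of [p] and [q] is an
    elementary column operation, so unimodularity persists. *)
Lemma basis_clique_subdivide D : basis_clique V G K D -> range D p -> range D q ->
  basis_clique V (r :: G) K' (fun k => if D k == p then r else D k).
Proof.
move=> [DG DK uD] [i _ Di] [j _ Dj]; split.
- by move=> k; case: eqP => _; rewrite inE ?eqxx// DG orbT.
- move=> k l; case: eqP => [kp|/eqP kp]; case: eqP => [lp|/eqP lp].
  + exact: es_loop S.
  + by rewrite (es_link S)// -Di -Dj !DK.
  + by rewrite (es_linkC S)// (es_link S)// -Di -Dj !DK.
  + by rewrite (es_old S)// DK (negbTE kp) (negbTE lp) andbF.
have ij : i != j by apply: contra (es_neq S) => /eqP ij; rewrite -Di -Dj ij.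
have -> : column_matrix V (fun k => if D k == p then r else D k) =
    column_matrix V D *m (1%:M + delta_mx j i).
  rewrite mulmxDr mulmx1; apply/matrixP => a k.
  rewrite !mxE (bigD1 j)//= big1 => [|l lj]; last by rewrite !mxE (negbTE lj) mulr0.
  rewrite !mxE eqxx /= addr0 -Di (inj_eq (basis_inj R uD)).
  by case: eqP => [->|_]; rewrite ?mulr0 ?addr0// mulr1 (es_sum S) Di Dj !mxE.
rewrite unitmx_mul uD /=.
have /mulmx1_unit[//] : (1%:M + delta_mx j i) *m (1%:M - delta_mx j i) = 1%:M :> 'M[int]_n.
rewrite mulmxDl !mulmxDr !mulmx1 mul1mx mulmxN mul_delta_mx_0// oppr0 addr0.
by rewrite subrK.
Qed.

End Cliques.

Section Subdivision.
Variables (G : seq T) (K : rel T) (p q r : T) (K' : rel T).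
Hypothesis S : edge_subdivision G K p q r K'.

Let GK := es_system S.

Let neq_new x : x \in G -> (x == r) = false.
Proof. by move=> xG; apply/negbTE/eqP => xr; move: (es_new S); rewrite -xr xG. Qed.

(** If a new clique together with [p] and [q] was an old clique, it omits [p] or
    [q], and the omitted one is replaced by [r] in an old basis clique.
    Otherwise an old basis clique around it cannot contain both [p] and [q], so
    it survives. *)
Lemma subdivision_basis A : clique (r :: G) K' A ->
  exists D, basis_clique V (r :: G) K' D /\ A `<=` range D.
Proof.
move=> cA; have [AG AK] := cA.
have [cApq|nApq] := pselect (clique G K ((A `&` [set` G]) `|` [set p; q])).
  have [D [bD AD]] := us_basis GK cApq.
  have Dp : range D p by apply: AD; right; left.
  have Dq : range D q by apply: AD; right; right.
  have sub s : range D s -> ~ A s ->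
      A `<=` range (fun k => if D k == s then r else D k).
    move=> [i _ Di] nAs c Ac; have := AG _ Ac; rewrite /= inE => /orP[/eqP->|cG].
      by exists i; rewrite ?Di ?eqxx.
    have [k _ Dk] : range D c by apply: AD; left.
    exists k; rewrite // Dk; case: eqP => // cs.
    by case: nAs; rewrite -cs.
  have [Ap|nAp] := pselect (A p).
    have nAq : ~ A q by move=> Aq; apply: (clique_not_edge S cA).
    exists (fun k => if D k == q then r else D k); split; last exact: sub.
    by apply: (basis_clique_subdivide (edge_subdivisionC S)).
  exists (fun k => if D k == p then r else D k); split; last exact: sub.
  exact: (basis_clique_subdivide S).
have nAr : ~ A r by move=> Ar; apply: nApq; exact: (clique_join S).
have [D [bD AD]] := us_basis GK (clique_old S cA).
have cD := basis_clique_clique bD.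
have npq : ~ (range D p /\ range D q).
  move=> [Dp Dq]; apply: nApq; apply: cliqueS cD => c [/AD//|[->|->]//].
exists D; split.
  have [DG' DK'] := clique_keep S cD npq.
  split; [by move=> i; apply: DG'; exists i| |by case: bD].
  by move=> i j; apply: DK'; [exists i|exists j].
move=> c Ac; apply: AD; split=> //; have := AG _ Ac.
by rewrite /= inE => /orP[/eqP cr|//]; case: nAr; rewrite -cr.
Qed.

(** The smaller of the coefficients of [p] and [q] is transferred to [r], after
    which [p] or [q] has coefficient 0. *)
Lemma subdivision_ex (w : 'cV[R]_n) : exists f, represents V (r :: G) K' f w.
Proof.
have [f [f0 [fG fK] ->]] := us_ex GK w.
have [pG qG] := (es_p S, es_q S).
pose m := Num.min (f p) (f q).
have m0 : 0 <= m by rewrite le_min !f0.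
pose g c := f c + - m * (p == c)%:R + - m * (q == c)%:R.
pose h c := if c == r then m else g c.
have pq : (p == q) = false by exact/negbTE/(es_neq S).
have hE c : c \in G -> h c = g c by move=> cG; rewrite /h neq_new.
have gpq : g p = 0 \/ g q = 0.
  rewrite /g !eqxx pq [q == p]eq_sym pq /= !(mulr0, addr0, mulr1).
  by rewrite /m; have [?|?] := leP (f p) (f q); [left|right]; rewrite subrr.
have supph c : h c != 0 -> c = r /\ m != 0 \/ c \in G /\ f c != 0 /\ g c != 0.
  rewrite /h; case: (eqVneq c r) => [->|cr gc]; first by left.
  right; suff fc : f c != 0 by split=> //; exact: fG.
  apply: contra gc => /eqP fc; rewrite /g fc.
  have mz : f c = f p \/ f c = f q -> m = 0.
    by rewrite fc /m => -[] <-; [rewrite min_l|rewrite min_r].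
  case: (eqVneq p c) => [pc|_]; last case: (eqVneq q c) => [qc|_].
  - by rewrite mz ?oppr0 ?mul0r ?addr0//; left; rewrite pc.
  - by rewrite mz ?oppr0 ?mul0r ?addr0//; right; rewrite qc.
  - by rewrite !mulr0 !addr0.
have mpq : m != 0 -> f p != 0 /\ f q != 0.
  by move=> mz; split; apply: contra mz => /eqP e; rewrite /m e;
    [rewrite min_l|rewrite min_r].
exists h; split.
- move=> c; rewrite /h; case: eqP => // _; rewrite /g.
  case: (eqVneq p c) => [<-|_]; rewrite ?[q == p]eq_sym ?pq /= ?mulr1 ?mulr0 ?addr0.
    by rewrite subr_ge0 ge_min lexx.
  case: (eqVneq q c) => [<-|_]; rewrite /= ?mulr1 ?mulr0 ?addr0//.
  by rewrite subr_ge0 ge_min lexx orbT.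
- split=> [c /supph [[-> _]|[cG _]]|x y /supph hx /supph hy]; rewrite /= ?inE ?eqxx ?cG ?orbT//.
  case: hx hy => [[-> mz]|[xG [fx gx]]] [[-> mz']|[yG [fy gy]]].
  + exact: es_loop S.
  + by have [fp fq] := mpq mz; rewrite (es_link S)//; apply/andP; split; apply: fK.
  + have [fp fq] : f p != 0 /\ f q != 0 by exact: mpq.
    by rewrite (es_linkC S)// (es_link S)//; apply/andP; split; apply: fK.
  + rewrite (es_old S)// [K x y]fK//=; apply/negP => /orP[] /andP[/eqP xp /eqP yq];
    by case: gpq => e; move: gx gy; rewrite xp yq e ?eqxx.
- rewrite /comb big_cons {1}/h eqxx.
  have -> : \sum_(c <- G) h c *: intv R (V c) = comb V G g.
    by rewrite /comb !big_seq; apply: eq_bigr => c /hE ->.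
  rewrite /g 2!combD !comb_delta ?(us_uniq GK)//.
  rewrite (es_sum S) intvD scalerDr !scaleNr.
  by rewrite addrC -[X in X + _]addrA -opprD subrK.
Qed.

(** Inverse of the transfer above: the coefficient of [r] is given back to [p]
    and [q]. *)
Lemma subdivision_lift f w : represents V (r :: G) K' f w ->
  represents V G K
    (fun c => if c == r then 0 else f c + f r * (p == c)%:R + f r * (q == c)%:R) w.
Proof.
move=> [f0 cf ->]; have [fG fK] := cf.
have [pG qG] := (es_p S, es_q S).
set g := fun c => if c == r then 0 else _.
have suppg c : g c != 0 -> ((supp f `&` [set` G]) c) \/ (supp f r /\ [set p; q] c).
  rewrite /g; case: (eqVneq c r) => [|cr]; first by rewrite eqxx.
  have [fc|fc] := eqVneq (f c) 0; last first.
    by move=> _; left; split=> //; have := fG _ fc; rewrite /= inE (negbTE cr).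
  rewrite fc add0r => h; right; split.
    by rewrite /supp/=; apply: contra h => /eqP ->; rewrite !mul0r addr0.
  case: (eqVneq p c) h => [->|_]; first by left.
  by case: (eqVneq q c) => [->|_]; [right|rewrite !mulr0 addr0 eqxx].
split.
- by move=> c; rewrite /g; case: eqP => // _; rewrite !addr_ge0// mulr_ge0// ler0n.
- have [fr|fr] := eqVneq (f r) 0.
    apply: cliqueS (clique_old S cf) => c /suppg[//|[]].
    by rewrite /supp/= fr eqxx.
  apply: cliqueS (clique_join S cf fr) => c /suppg[?|[_ ?]]; [left|right] => //.
- rewrite /comb big_cons.
  have -> : \sum_(c <- G) g c *: intv R (V c) =
      comb V G (fun c => f c + f r * (p == c)%:R + f r * (q == c)%:R).
    by rewrite /comb !big_seq; apply: eq_bigr => c cG; rewrite /g neq_new.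
  rewrite 2!combD !comb_delta ?(us_uniq GK)// (es_sum S) intvD scalerDr.
  by rewrite [LHS]addrC addrA.
Qed.

(** Both representations give the same old one; the coefficient of [r] is
    recovered from it as the minimum of those of [p] and [q], because these
    two labels are no longer compatible. *)
Lemma subdivision_unique f g w : represents V (r :: G) K' f w ->
  represents V (r :: G) K' g w -> f = g.
Proof.
move=> rf rg.
have fg := us_unique GK (subdivision_lift rf) (subdivision_lift rg).
have fgE c := congr1 (fun h => h c) fg.
have pq : (p == q) = false by exact/negbTE/(es_neq S).
have minr (h : T -> R) : represents V (r :: G) K' h w ->
    h r = Num.min (h p + h r) (h q + h r).
  move=> [h0 ch _]; have := clique_not_edge S ch.
  have [-> _|hp] := eqVneq (h p) 0; first by rewrite add0r min_l// lerDr.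
  have [-> _|hq []//] := eqVneq (h q) 0; by rewrite add0r min_r// lerDr.
have er : f r = g r.
  rewrite (minr f)// (minr g)//; have := fgE p; have := fgE q.
  rewrite !neq_new ?(es_p S) ?(es_q S)// !eqxx pq eq_sym pq.
  by rewrite !(mulr0, addr0, mulr1) => -> ->.
apply: funext => c; have := fgE c; case: eqP => [->//|_].
by rewrite er => /addIr/addIr.
Qed.

Lemma subdivision_system : unimodular_system R V (r :: G) K'.
Proof.
have KE c c' : c \in r :: G -> c' \in r :: G -> K' c c' = K' c' c.
  rewrite !inE => /orP[/eqP->|cG] /orP[/eqP->|c'G]//.
  - by rewrite (es_linkC S).
  - by rewrite (es_linkC S).
  by rewrite !(es_old S)// (us_sym GK)//; congr (_ && ~~ _); rewrite orbC andbC [X in _ || X]andbC.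
split=> //.
- by rewrite /= (es_new S) (us_uniq GK).
- move=> c; rewrite inE => /orP[/eqP->|cG]; first exact: es_loop S.
  rewrite (es_old S)// (us_refl GK)//=; apply/negP => /orP[] /andP[/eqP-> /eqP e];
    by move: (es_neq S); rewrite e eqxx.
- exact: subdivision_basis.
- exact: subdivision_ex.
- exact: subdivision_unique.
Qed.

Local Notation C := (label_cone R V).

Lemma edge_clique : clique G K [set p; q].
Proof.
have [pG qG] := (es_p S, es_q S).
split=> [c [->|->]//|x y [->|->] [->|->]]; do ?[exact: us_refl GK _ _].
- exact: es_edge S.
- by rewrite (us_sym GK)//; exact: es_edge S.
Qed.

Lemma rays_edge : rays (C [set p; q]) = [set V p; V q].
Proof. by rewrite (rays_label_cone GK edge_clique) image_setU !image_set1. Qed.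

Lemma ray_sum_edge : ray_sum (C [set p; q]) = V r.
Proof.
have pq : V p != V q.
  have e := @label_inj _ _ _ _ _ _ GK p q (es_p S) (es_q S).
  by apply: contra (es_neq S) => /eqP/e ->.
rewrite /ray_sum rays_edge (es_sum S).
have -> : [set V p; V q] = [set` [:: V p; V q]].
  apply/seteqP; split=> u /=; rewrite !inE.
    by case=> ->; rewrite eqxx ?orbT.
  by case/orP => /eqP ->; [left|right].
by rewrite -fsbig_seq/= ?inE ?pq// big_cons big_seq1.
Qed.

Lemma edge_subset A : clique G K A -> C [set p; q] `<=` C A <-> (A p /\ A q).
Proof.
move=> cA; split=> [sub|[Ap Aq]]; last by apply: coneS => c [->|->].
have pqA : [set p; q] `<=` A by apply: (cone_sub GK) => //; case: edge_clique.
by split; apply: pqA; [left|right].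
Qed.

(** In both directions a cone with the new ray corresponds to a face of the
    closed star of the old edge that does not contain the edge. *)
Lemma star_subdivisionE :
  star_subdivision (C [set p; q]) (clique_fan R V G K) =
  clique_fan R V (r :: G) K'.
Proof.
have VI := label_inj subdivision_system.
have inr c : c \in G -> c \in r :: G by rewrite inE orbC => ->.
have [pG qG] := (es_p S, es_q S).
apply/seteqP; split=> F.
  move=> [[[A cA <-] nA]|].
    exists A => //; apply: clique_keep S _ _ _ => // Apq.
    by apply: nA; apply/edge_subset.
  move=> [_ [B [[A cA <-] sub BA nB ->]]].
  have /edge_subset-/(_ cA)[Ap Aq] := sub.
  move: BA nB; rewrite rays_edge ray_sum_edge (rays_label_cone GK cA) => BA nB.
  pose A' := [set c | (A c \/ c = r) /\ B (V c)].
  have BE : B = V @` A'.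
    apply/seteqP; split=> [u Bu|_ [c [_ Bc] <-]//].
    have [[c Ac cu]|ur] := BA _ Bu; last first.
      by rewrite (ur : u = V r); exists r => //; split; [right|rewrite -(ur : u = V r)].
    by exists c => //; split; [left|rewrite cu].
  exists A'; last by rewrite /label_cone BE.
  have [AG AK] := cA.
  split=> [c [[/AG/inr//|->] _]|x y]; first by rewrite /= inE eqxx.
  move=> [[Ax|->] Bx] [[Ay|->] By].
  - rewrite (es_old S) ?AK//=; [|exact: AG|exact: AG].
    apply/negP => /orP[] /andP[/eqP xp /eqP yq]; apply: nB => _ [->|->];
      by rewrite -?xp -?yq.
  - by rewrite (es_linkC S) ?(es_link S) ?AK//; exact: AG.
  - by rewrite (es_link S) ?AK//; exact: AG.
  - exact: es_loop S.
move=> [A cA <-]; have [Ar|nAr] := pselect (A r).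
  right; exists (C (A `&` [set` G] `|` [set p; q])), (V @` A).
  have cAp := clique_join S cA Ar.
  split=> //.
  - by exists (A `&` [set` G] `|` [set p; q]).
  - by apply/edge_subset => //; split; right; [left|right].
  - rewrite ray_sum_edge (rays_label_cone GK cAp) => _ [c Ac <-].
    case: cA => /(_ _ Ac) + _; rewrite /= inE => /orP[/eqP->|cG]; first by right.
    by left; exists c => //; left.
  - rewrite rays_edge => sub; apply: (clique_not_edge S cA).
    have VA c : c \in G -> (V @` A) (V c) -> A c.
      move=> cG [c' Ac' e]; rewrite -(VI c' c)//; last exact: inr.
      by case: cA => AG _; exact: AG.
    by split; apply: VA => //; apply: sub; [left|right].
left; have cA' : clique G K A.
  apply: cliqueS (clique_old S cA) => c Ac; split=> //.
  case: cA => /(_ _ Ac) + _; rewrite /= inE => /orP[/eqP cr|//].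
  by case: nAr; rewrite -cr.
split; first by exists A.
by move/edge_subset => /(_ cA'); exact: (clique_not_edge S cA).
Qed.

End Subdivision.
End EdgeSubdivision.

(** * Compatibility of chords *)

Section Chords.
Variable n : nat.
Implicit Types (d : nat) (c : chord).

Lemma dchordE d c : dchord d n c <->
  [|| [&& c.1 == 1, 3 <= c.2 & c.2 <= n + 2],
      [&& c.2 == n + 3, 2 <= c.1 & c.1 <= n + 1]
    | [&& 2 <= c.1, c.1 < c.2, c.2 <= n + 2, 2 <= c.2 - c.1
        & c.2 - c.1 <= d]]%N.
Proof.
split=> [[[/eqP-> -> ->]|[/eqP-> -> ->]|[-> -> -> -> ->]]|]; rewrite ?orbT//.
case/or3P => [/and3P[/eqP? ? ?]|/and3P[/eqP? ? ?]|/and5P[? ? ? ? ?]].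
- by constructor 1.
- by constructor 2.
- by constructor 3.
Qed.

Lemma compatibleC d c c' : compatible d n c c' = compatible d n c' c.
Proof.
rewrite /compatible; congr (_ || _); last exact: orbC.
by rewrite /crossing orbC.
Qed.

Lemma compatible_refl d c : compatible d n c c.
Proof. by rewrite /compatible /crossing !ltnn !andbF. Qed.

End Chords.

Section ChordSystems.
Variables (R : realType) (n : nat).
Implicit Types (d i j : nat) (c : chord).

(** For [d = 1] the labels are the positive and negative coordinate vectors, and
    the fan is that of the coordinate orthants. *)
Definition unit_chords : seq chord :=
  [seq (1, i.+3)%N | i : 'I_n] ++ [seq (i.+2, n + 3)%N | i : 'I_n].

Lemma mem_unit_chords c : (c \in unit_chords) <->
  exists i : 'I_n, c = (1, i.+3)%N \/ c = (i.+2, n + 3)%N.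
Proof.
rewrite mem_cat; split.
  by move=> /orP[] /mapP[i _ ->]; exists i; [left|right].
by move=> [i [->|->]]; apply/orP; [left|right]; apply: map_f; rewrite mem_enum.
Qed.

Lemma unit_chordsE : [set` unit_chords] = dchord 1 n.
Proof.
apply/seteqP; split=> [c /mem_unit_chords[i ci]|[a b]].
  by apply/dchordE; have := ltn_ord i; case: ci => -> /=; lia.
move=> abP; apply/mem_unit_chords.
case: abP => /= [[-> b3 bn]|[-> a2 an]|[]]; last by lia.
  have bb : (b - 3 < n)%N by lia.
  by exists (Ordinal bb); left; congr pair; rewrite /=; lia.
have aa : (a - 2 < n)%N by lia.
by exists (Ordinal aa); right; congr pair; rewrite /=; lia.
Qed.

Lemma unit_chords_uniq : uniq unit_chords.
Proof.
have left_inj : injective (fun i : 'I_n => (1, i.+3)%N) by move=> i k [/val_inj].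
have right_inj : injective (fun i : 'I_n => (i.+2, n + 3)%N) by move=> i k [/val_inj].
rewrite cat_uniq (map_inj_uniq left_inj) (map_inj_uniq right_inj).
rewrite enum_uniq andbT /=.
by apply/hasPn => _ /mapP[i _ ->]; apply/mapP => -[k _ []].
Qed.

Lemma unit_compatible_left (i k : 'I_n) :
  compatible 1 n (1, i.+3)%N (1, k.+3)%N.
Proof. rewrite /compatible /crossing /far_pair /=; lia. Qed.

Lemma unit_compatible_right (i k : 'I_n) :
  compatible 1 n (i.+2, n + 3)%N (k.+2, n + 3)%N.
Proof. have := ltn_ord i; rewrite /compatible /crossing /far_pair /=; lia. Qed.

Lemma unit_compatible (i k : 'I_n) :
  compatible 1 n (1, i.+3)%N (k.+2, n + 3)%N = (i != k).
Proof.
have := ltn_ord i; have := ltn_ord k; rewrite -val_eqE /=.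
rewrite /compatible /crossing /far_pair /=; lia.
Qed.

Lemma chord_vec_left (i : 'I_n) : chord_vec n (1, i.+3)%N = - basis_vec n i.+1.
Proof. by rewrite /chord_vec /= subn2. Qed.

Lemma chord_vec_right (i : 'I_n) : chord_vec n (i.+2, n + 3)%N = basis_vec n i.+1.
Proof. by rewrite /chord_vec /= eqxx subn1. Qed.

Lemma unit_combE (f : chord -> R) (k : 'I_n) :
  comb (chord_vec n) unit_chords f k 0 = f (k.+2, n + 3)%N - f (1, k.+3)%N.
Proof.
rewrite /comb big_cat !big_image /= mxE !summxE.
rewrite (bigD1 k)//= [X in _ + X](bigD1 k)//= !big1 => [|i ik|i ik].
- rewrite chord_vec_left chord_vec_right !mxE eqxx !addr0 /=.
  by rewrite rmorphN /= mulrN !mulr1 addrC.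
- rewrite chord_vec_right !mxE eqSS; case: eqP => [/val_inj ki|_].
    by rewrite ki eqxx in ik.
  by rewrite mulr0.
- rewrite chord_vec_left !mxE eqSS; case: eqP => [/val_inj ki|_].
    by rewrite ki eqxx in ik.
  by rewrite oppr0 mulr0.
Qed.

(** A clique chooses a sign for each coordinate, and the representation of a
    vector consists of its positive and negative parts. *)
Lemma unit_system :
  unimodular_system R (chord_vec n) unit_chords (compatible 1 n).
Proof.
split.
- exact: unit_chords_uniq.
- by move=> c _; exact: compatible_refl.
- by move=> c c' _ _; exact: compatibleC.
- move=> A [AG AK].
  pose D (i : 'I_n) : chord :=
    if `[< A (1, i.+3)%N >] then (1, i.+3)%N else (i.+2, n + 3)%N.
  exists D; split; last first.
    move=> c Ac; have /mem_unit_chords[i [ci|ci]] := AG _ Ac; exists i; rewrite // /D.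
      by rewrite asboolT// -ci.
    rewrite asboolF// => Ai; have := AK _ _ Ai Ac.
    by rewrite ci unit_compatible eqxx.
  split.
  + by move=> i; apply/mem_unit_chords; exists i; rewrite /D; case: ifP; [left|right].
  + have DD (i k : 'I_n) : compatible 1 n (D i) (D k).
      have [->|ik] := eqVneq i k; first exact: compatible_refl.
      rewrite /D; case: ifP => _; case: ifP => _.
      * exact: unit_compatible_left.
      * by rewrite unit_compatible.
      * by rewrite compatibleC unit_compatible eq_sym.
      * exact: unit_compatible_right.
    exact: DD.
  + pose s (i : 'I_n) : int := (-1) ^+ `[< A (1, i.+3)%N >].
    have -> : column_matrix (chord_vec n) D = diag_mx (\row_i s i).
      apply/matrixP => i k; rewrite !mxE /D /s.
      have [<-|ik] := eqVneq i k; case: asboolP => _;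
        rewrite ?chord_vec_left ?chord_vec_right !mxE eqSS val_eqE.
      * by rewrite eqxx expr1.
      * by rewrite eqxx expr0.
      * by rewrite (negbTE ik) oppr0.
      * by rewrite (negbTE ik).
    rewrite unitmxE det_diag; elim/big_ind: _ => [|x y ux uy|i _].
    * exact: unitr1.
    * by rewrite unitrM ux.
    * by rewrite mxE /s unitrX// unitrN1.
- move=> w.
  pose f c : R := \sum_(i < n) ((c == (1, i.+3)%N)%:R * Num.max (- w i 0) 0 +
    (c == (i.+2, n + 3)%N)%:R * Num.max (w i 0) 0).
  have fl k : f (1, k.+3)%N = if insub k is Some i then Num.max (- w i 0) 0 else 0.
    rewrite /f; case: insubP => [i _ <-|kn].
      rewrite (bigD1 i)//= big1 ?eqxx ?mul1r ?mul0r ?addr0// => l li.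
      rewrite !xpair_eqE /= !eqSS val_eqE eq_sym (negbTE li) !mul0r.
      by rewrite addr0.
    rewrite big1// => l _; rewrite !xpair_eqE /= !eqSS mul0r addr0.
    by case: eqP => [kl|]; rewrite ?mul0r//; move: kn; rewrite kl ltn_ord.
  have fl' (k : 'I_n) : f (1, k.+3)%N = Num.max (- w k 0) 0 by rewrite fl valK.
  have fr' (k : 'I_n) : f (k.+2, n + 3)%N = Num.max (w k 0) 0.
    rewrite /f (bigD1 k)//= big1 ?eqxx ?mul1r ?mul0r ?add0r ?addr0// => l li.
    by rewrite !xpair_eqE /= !eqSS val_eqE eq_sym (negbTE li) !mul0r addr0.
  have fG c : f c != 0 -> c \in unit_chords.
    move=> fc; apply/mem_unit_chords; apply: contrapT => /forallNP nc.
    case/negP: fc; apply/eqP; rewrite /f big1// => i _.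
    have := nc i => /not_orP[/eqP/negbTE-> /eqP/negbTE->].
    by rewrite !mul0r addr0.
  have npq (k : 'I_n) : f (1, k.+3)%N != 0 -> f (k.+2, n + 3)%N != 0 -> False.
    rewrite fl' fr'; case/orP: (le_total 0 (w k 0)) => wk.
      by rewrite max_r ?oppr_le0// eqxx.
    by rewrite [Num.max (w k 0) _]max_r// eqxx.
  exists f; split.
  + by move=> c; apply: sumr_ge0 => i _; rewrite addr_ge0// mulr_ge0// le_max lexx orbT.
  + split=> [c /fG//|c c' fc fc'].
    have /mem_unit_chords[i ci] := fG _ fc; have /mem_unit_chords[k ck] := fG _ fc'.
    case: ci ck fc fc' => [->|->] [->|->] fi fk.
    * exact: unit_compatible_left.
    * rewrite unit_compatible; apply/eqP => ik; rewrite -ik in fk; exact: (npq i).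
    * rewrite compatibleC unit_compatible; apply/eqP => ik; rewrite -ik in fi; exact: (npq k).
    * exact: unit_compatible_right.
  + apply/matrixP => k l; rewrite ord1 unit_combE fl' fr'.
    case/orP: (le_total 0 (w k 0)) => wk.
      by rewrite max_l// max_r ?oppr_le0// subr0.
    by rewrite max_r// max_l ?oppr_ge0// sub0r opprK.
- move=> f g w [f0 [fG fK] wf] [g0 [gG gK] wg].
  have eqk (k : 'I_n) : f (1, k.+3)%N = g (1, k.+3)%N /\
      f (k.+2, n + 3)%N = g (k.+2, n + 3)%N.
    have wk : f (k.+2, n + 3)%N - f (1, k.+3)%N = g (k.+2, n + 3)%N - g (1, k.+3)%N.
      by rewrite -!unit_combE -wf -wg.
    have ff : f (k.+2, n + 3)%N = 0 \/ f (1, k.+3)%N = 0.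
      have [|e1] := eqVneq (f (k.+2, n + 3)%N) 0; first by left.
      have [|e2] := eqVneq (f (1, k.+3)%N) 0; first by right.
      by have := fK _ _ e2 e1; rewrite unit_compatible eqxx.
    have gg : g (k.+2, n + 3)%N = 0 \/ g (1, k.+3)%N = 0.
      have [|e1] := eqVneq (g (k.+2, n + 3)%N) 0; first by left.
      have [|e2] := eqVneq (g (1, k.+3)%N) 0; first by right.
      by have := gK _ _ e2 e1; rewrite unit_compatible eqxx.
    have := f0 (1, k.+3)%N; have := f0 (k.+2, n + 3)%N.
    have := g0 (1, k.+3)%N; have := g0 (k.+2, n + 3)%N.
    by move: wk; case: ff => ->; case: gg => -> *; split; lra.
  apply: funext => c; have [cG|cG] := boolP (c \in unit_chords).
    by have /mem_unit_chords[i [->|->]] := cG; case: (eqk i).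
  have -> : f c = 0 by apply/eqP; apply: contraNT cG => /fG.
  by apply/esym/eqP; apply: contraNT cG => /gG.
Qed.

(** Compatibility between the levels [d.-1] and [d]: [s] lists the diagonals of
    length [d] inserted so far, whose edges have been subdivided. *)
Definition stage_far d (s : seq chord) c c' : bool :=
  [&& c.1 == 1, c'.2 == n + 3, 2 <= c'.1, c'.1 < c.2, c.2 <= n + 2,
      d <= c.2 - c'.1 & (c'.1, c.2) \notin s]%N.

Definition stage_compatible d (s : seq chord) c c' : bool :=
  [|| ~~ crossing c c', stage_far d s c c' | stage_far d s c' c].

Lemma stage_compatibleC d s c c' :
  stage_compatible d s c c' = stage_compatible d s c' c.
Proof.
rewrite /stage_compatible; congr (_ || _); last exact: orbC.
by rewrite /crossing orbC.
Qed.

Lemma stage_compatible0 d : (0 < d)%N ->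
  stage_compatible d [::] = compatible d.-1 n.
Proof.
move=> d0; apply: funext => c; apply: funext => c'.
by rewrite /stage_compatible /stage_far /compatible /far_pair !in_nil !andbT addn1 prednK.
Qed.

Definition diagonals d : seq chord := [seq (i, i + d)%N | i <- iota 2 (n.+1 - d)].

Lemma mem_diagonals d i j : ((i, j) \in diagonals d) <->
  [/\ 2 <= i, j = i + d & j <= n + 2]%N.
Proof.
split.
  by move=> /mapP[k]; rewrite mem_iota => ik [-> ->]; split=> //; lia.
by move=> [i2 -> jn]; apply: map_f; rewrite mem_iota; lia.
Qed.

Lemma diagonals_uniq d : uniq (diagonals d).
Proof. by rewrite map_inj_uniq ?iota_uniq// => i k []. Qed.

Lemma stage_compatible_diagonals d (s : seq chord) : s =i diagonals d ->
  stage_compatible d s = compatible d n.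
Proof.
move=> sd; suff e c c' : stage_far d s c c' = far_pair d n c c'.
  by apply: funext => c; apply: funext => c'; rewrite /stage_compatible !e.
case: c c' => a b [a' b']; rewrite /stage_far /far_pair /= sd.
have := mem_diagonals d a' b; case: (_ \in _) => /= -[h1 h2]; last first.
  have {}h2 : ~ [/\ 2 <= a', b = a' + d & b <= n + 2]%N by move/h2.
  have nh : ~ (2 <= a' /\ b = a' + d /\ b <= n + 2)%N by move=> [? [? ?]]; apply: h2.
  by lia.
by have [] := h1 isT; lia.
Qed.

(** Because interior chords have length at most [d = j - i], a chord present at
    this stage is compatible with both [1j] and [i(n+3)] exactly when it does
    not cross [ij].  This holds for every [s], so the diagonals of length [d]
    may be inserted in any order. *)
Lemma stage_edge d (s G : seq chord) i j : (2 <= d)%N ->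
  unimodular_system R (chord_vec n) G (stage_compatible d s) ->
  [set` G] = dchord d.-1 n `|` [set` s] ->
  {subset s <= diagonals d} -> (i, j) \in diagonals d -> (i, j) \notin s ->
  edge_subdivision R (chord_vec n) G (stage_compatible d s)
    (1, j)%N (i, n + 3)%N (i, j) (stage_compatible d ((i, j) :: s)).
Proof.
move=> d2 sG GE sd /mem_diagonals[i2 jE jn] ns.
have GP c : c \in G -> dchord d.-1 n c \/ c \in s.
  by move=> cG; have : [set` G] c by []; rewrite GE.
have inG c : dchord d.-1 n c -> c \in G.
  by move=> dc; suff : [set` G] c by []; rewrite GE; left.
split=> //.
- by apply: inG; apply/dchordE => /=; lia.
- by apply: inG; apply/dchordE => /=; lia.
- by rewrite xpair_eqE; lia.
- by rewrite /stage_compatible /stage_far /crossing /= ns; lia.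
- apply/negP => /GP[|]; last by rewrite (negbTE ns).
  by move=> /dchordE /=; lia.
- have i1 : i == 1%N = false by lia.
  have jn3 : j == (n + 3)%N = false by lia.
  by rewrite /chord_vec /= i1 jn3 eqxx addrC.
- move=> [a b] [a' b'] _ _.
  rewrite /stage_compatible /stage_far /crossing /= !in_cons !xpair_eqE.
  by case: ((a', b) \in s); case: ((a, b') \in s); lia.
- move=> [a b] /GP xP.
  have nsl : ((a, j) \in s) = false.
    apply/negP => aj; have /mem_diagonals[_ jE' _] := sd _ aj.
    have ai : a = i by lia.
    by move: ns; rewrite -ai aj.
  have nsr : ((i, b) \in s) = false.
    apply/negP => ib; have /mem_diagonals[_ bE _] := sd _ ib.
    have bj : b = j by lia.
    by move: ns; rewrite -bj ib.
  have {xP} : [|| [&& a == 1, 3 <= b & b <= n + 2],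
      [&& b == n + 3, 2 <= a & a <= n + 1]
      | [&& 2 <= a, a < b, b <= n + 2 & b - a <= d]]%N.
    by case: xP => [/dchordE /=|/sd/mem_diagonals[]]; lia.
  rewrite /stage_compatible /stage_far /crossing /= nsl nsr.
  by case: (_ \in _); case: (_ \in _); lia.
- by move=> x _; exact: stage_compatibleC.
- by rewrite /stage_compatible /crossing !ltnn !andbF.
Qed.

Lemma crossing_coneE c :
  label_cone R (chord_vec n) [set (1, c.2)%N; (c.1, n + 3)%N] = crossing_cone R n c.
Proof. by []. Qed.

Lemma clique_fan_ext (G G' : seq chord) (K : rel chord) : [set` G] = [set` G'] ->
  clique_fan R (chord_vec n) G K = clique_fan R (chord_vec n) G' K.
Proof. by move=> e; rewrite /clique_fan /clique e. Qed.

(** The list [s] grows at its head, hence the reversal in the sequence of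
    subdivisions. *)
Lemma stage_system d (G : seq chord) (s : seq chord) : (2 <= d)%N ->
  unimodular_system R (chord_vec n) G (compatible d.-1 n) ->
  [set` G] = dchord d.-1 n ->
  uniq s -> {subset s <= diagonals d} ->
  unimodular_system R (chord_vec n) (s ++ G) (stage_compatible d s) /\
  star_subdivisions (clique_fan R (chord_vec n) G (compatible d.-1 n)) (rev s) =
    clique_fan R (chord_vec n) (s ++ G) (stage_compatible d s).
Proof.
move=> d2 sG GE; elim: s => [_ _|[i j] s IH /andP[ns us] sd].
  by rewrite stage_compatible0// ltnW.
have sd' : {subset s <= diagonals d} by move=> c cs; apply: sd; rewrite inE cs orbT.
have [sS fS] := IH us sd'.
have edge : edge_subdivision R (chord_vec n) (s ++ G) (stage_compatible d s)
    (1, j)%N (i, n + 3)%N (i, j) (stage_compatible d ((i, j) :: s)).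
  apply: stage_edge => //.
  - rewrite -GE setUC; apply/seteqP; split=> c /=; rewrite mem_cat.
      by case/orP; [left|right].
    by case=> ->; rewrite ?orbT.
  - by apply: sd; rewrite inE eqxx.
split; first exact: (subdivision_system edge).
rewrite rev_cons /star_subdivisions foldl_rcons -/(star_subdivisions _ _) fS.
by rewrite -crossing_coneE (star_subdivisionE edge).
Qed.

Lemma dchord_split d : (2 <= d <= n)%N ->
  [set` diagonals d] `|` dchord d.-1 n = dchord d n.
Proof.
move=> dn; apply/seteqP; split=> -[a b].
  case=> [/= /mem_diagonals[]|/dchordE /= h]; first by move=> *; apply/dchordE => /=; lia.
  by apply/dchordE => /=; lia.
move=> /dchordE /= h; have [ba|ba] := eqVneq b (a + d)%N.
  case/boolP: ((2 <= a) && (b <= n + 2))%N => [/andP[a2 bn]|ab].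
    by left; apply/mem_diagonals.
  by right; apply/dchordE => /=; lia.
by right; apply/dchordE => /=; lia.
Qed.

Lemma chord_system d : (1 <= d <= n)%N -> exists G,
  unimodular_system R (chord_vec n) G (compatible d n) /\ [set` G] = dchord d n.
Proof.
case: d => // d; elim: d => [_|d IH /andP[_ dn]].
  by exists unit_chords; split; [exact: unit_system|exact: unit_chordsE].
have [G [sG GE]] := IH (ltnW dn).
have [sS _] := @stage_system d.+2 G (diagonals d.+2) isT sG GE
  (diagonals_uniq _) (fun=> id).
exists (diagonals d.+2 ++ G); split; first by rewrite -(stage_compatible_diagonals (s := diagonals d.+2)).
rewrite -dchord_split//= -GE; apply/seteqP; split=> c /=; rewrite mem_cat.
  by case/orP; [left|right].
by case=> ->; rewrite ?orbT.
Qed.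

End ChordSystems.

(** * Normal fans from common minimizers *)

Section CommonMinimizers.
Variables (R : realType) (n : nat).
Implicit Types (P Q X : set 'rV[R]_n) (W : set 'cV[R]_n) (v : 'rV[R]_n).

(** All functionals of [W] attain their minimum over [P] at the same point [v]. *)
Definition minimizes P W v : Prop :=
  P v /\ forall w v', W w -> P v' -> pairing v w <= pairing v' w.

(** A sum is minimal exactly when both summands are, so common minimizers of a
    Minkowski sum can be studied one summand at a time. *)
Lemma minkowski_sum_min P Q W :
  (exists v, minimizes (minkowski_sum P Q) W v) <->
  (exists v, minimizes P W v) /\ (exists v, minimizes Q W v).
Proof.
split=> [[_ [[x Px [y Qy <-]] min]]|[[x [Px xmin]] [y [Qy ymin]]]].
  split; [exists x|exists y]; split=> // w v' Ww v'in.
    have /(min w)-/(_ Ww) : minkowski_sum P Q (v' + y) by exists v' => //; exists y.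
    by rewrite !pairingDl lerD2r.
  have /(min w)-/(_ Ww) : minkowski_sum P Q (x + v') by exists x => //; exists v'.
  by rewrite !pairingDl lerD2l.
exists (x + y); split; first by exists x => //; exists y.
move=> w _ Ww [x' Px' [y' Qy' <-]]; rewrite !pairingDl.
by apply: lerD; [exact: xmin|exact: ymin].
Qed.

Lemma big_minkowski_min (I : eqType) (s : seq I) (Q : I -> set 'rV[R]_n) W :
  (exists v, minimizes (\big[@minkowski_sum R n/[set 0]]_(i <- s) Q i) W v) <->
  (forall i, i \in s -> exists v, minimizes (Q i) W v).
Proof.
elim: s => [|i s IH].
  rewrite big_nil; split=> // _; exists 0; split=> // w v' _ ->.
  exact: lexx.
rewrite big_cons minkowski_sum_min IH; split=> [[mi ms] j|ms].
  by rewrite inE => /orP[/eqP->//|]; exact: ms.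
by split=> [|j js]; apply: ms; rewrite inE ?eqxx// js orbT.
Qed.

(** A convex combination is a minimizer only if every point with a positive
    coefficient is one. *)
Lemma convex_hull_min X W :
  (exists v, minimizes (convex_hull X) W v) <-> (exists v, minimizes X W v).
Proof.
split=> [[v [[m [c [a [c0 c1 aX vE]]]] min]]|[v [Xv min]]].
  have [i ci] : exists i, 0 < c i.
    apply: contrapT => /forallNP nc; move/eqP: c1.
    rewrite big1 ?(eq_sym 0) ?oner_eq0// => i _.
    by apply/eqP; rewrite eq_le c0 leNgt andbT; apply/negP/nc.
  have hullX x : X x -> convex_hull X x.
    move=> Xx; exists 1%N, (fun=> 1), (fun=> x).
    by split; rewrite // big_ord1 ?scale1r.
  exists (a i); split=> // w v' Ww Xv'.
  apply: le_trans (min _ _ Ww (hullX _ Xv')).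
  have : \sum_k c k * (pairing (a k) w - pairing v w) = 0.
    under eq_bigr do rewrite mulrBr.
    rewrite big_split /= sumrN -mulr_suml c1 mul1r.
    rewrite vE pairing_suml; apply/eqP; rewrite subr_eq0; apply/eqP.
    by apply: eq_bigr => k _; rewrite pairingZl.
  move/eqP; rewrite psumr_eq0 => [|k _]; last first.
    by rewrite mulr_ge0// subr_ge0; exact: min _ _ Ww (hullX _ (aX k)).
  move=> /allP/(_ i); rewrite mem_index_enum => /(_ isT) /=.
  by rewrite mulf_eq0 gt_eqF//= subr_eq0 => /eqP ->.
exists v; split.
  exists 1%N, (fun=> 1), (fun=> v).
  by split; rewrite // big_ord1 ?scale1r.
move=> w _ Ww [m [c [a [c0 c1 aX ->]]]].
rewrite pairing_suml -[leLHS]mul1r -c1 mulr_suml; apply: ler_sum => k _.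
by rewrite pairingZl ler_wpM2l//; exact: min.
Qed.

End CommonMinimizers.

Section NormalFan.
Variables (R : realType) (n : nat) (T : eqType) (V : T -> 'cV[int]_n).
Variables (G : seq T) (K : rel T) (P : set 'rV[R]_n).
Hypothesis GK : unimodular_system R V G K.

Local Notation C := (label_cone R V).
Local Notation rays_of A := ((intv R \o V) @` A).

Hypothesis clique_min : forall A, clique G K A -> exists v, minimizes P (rays_of A) v.
Hypothesis min_compatible : forall c c', c \in G -> c' \in G ->
  (exists v, minimizes P (rays_of [set c; c']) v) -> K c c'.

(** The cone generators in the support of [w] have a common minimizer, so the
    minimum is additive on their cone; a minimizer of [w] then minimizes each of
    them. *)
Lemma minimizes_support v w f : represents V G K f w ->
  minimizes P [set w] v -> minimizes P (rays_of (supp f)) v.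
Proof.
move=> [f0 cf wf] [Pv min]; split=> // _ v' [c fc <-] Pv' /=.
have [v0 [Pv0 min0]] := clique_min cf.
have suppc t : f t != 0 -> rays_of (supp f) (intv R (V t)) by move=> ft; exists t.
apply: le_trans (min0 _ _ (suppc _ fc) Pv').
have : \sum_(t <- G) f t * (pairing v (intv R (V t)) - pairing v0 (intv R (V t))) = 0.
  apply/eqP; rewrite eq_le; apply/andP; split.
    under eq_bigr do rewrite mulrBr.
    rewrite big_split /= sumrN -!pairing_comb -wf subr_le0.
    exact: min.
  apply: sumr_ge0 => t _.
  have [->|ft] := eqVneq (f t) 0; first by rewrite mul0r.
  by rewrite mulr_ge0// subr_ge0 min0//; exact: suppc.
move/eqP; rewrite psumr_eq0 => [|t _]; last first.
  have [->|ft] := eqVneq (f t) 0; first by rewrite mul0r.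
  by rewrite mulr_ge0// subr_ge0 min0//; exact: suppc.
have cG : c \in G by case: cf => fG _; exact: fG.
move=> /allP/(_ c cG) /=.
by rewrite mulf_eq0 (negbTE fc) subr_eq0 => /eqP ->.
Qed.

(** The inclusion of the normal cone in the cone over [D] is the essential one:
    if [w] lies in the normal cone, then [v] minimizes the support of [w] as
    well as [D]; the union is a clique by compatibility, and [D] is maximal. *)
Lemma normal_cone_clique D v : basis_clique V G K D ->
  minimizes P (rays_of (range D)) v -> normal_cone P v = C (range D).
Proof.
move=> bD [Pv min]; have cD := basis_clique_clique bD.
apply/seteqP; split=> w.
  move=> wv; have [f fr] := us_ex GK w.
  have /(minimizes_support fr)[_ minf] : minimizes P [set w] v.
    by split=> // _ v' ->; exact: wv.
  have [_ [fG fK] _] := fr.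
  apply/(clique_coneP GK) => //; exists f => //.
  have cDf : clique G K (range D `|` supp f).
    split=> [c [/(proj1 cD)//|/fG//]|c c' Dc Dc'].
    have inG t : (range D `|` supp f) t -> t \in G by move=> [/(proj1 cD)//|/fG//].
    apply: min_compatible; [exact: inG|exact: inG|exists v; split=> //].
    move=> _ v' [t tcc <-] Pv'.
    have : (range D `|` supp f) t by case: tcc => ->.
    by case=> ht; [apply: min|apply: minf] => //; exists t.
  by rewrite -(basis_clique_maximal GK bD cDf (@subsetUl _ _ _)); exact: subsetUr.
move=> /(clique_coneP GK _ cD)[f [f0 _ ->] fD] v' Pv'.
rewrite !pairing_comb; apply: ler_sum => c _.
have [->|fc] := eqVneq (f c) 0; first by rewrite !mul0r.
by rewrite ler_wpM2l// min//; exists c => //; exact: fD.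
Qed.

(** The sum of the rays of a basis clique exposes [v]: another minimizer would
    agree with [v] on a basis of functionals. *)
Lemma vertex_clique D v : basis_clique V G K D ->
  minimizes P (rays_of (range D)) v -> vertex P v.
Proof.
move=> [_ _ uD] [Pv min]; split=> //.
exists (\sum_i intv R (V (D i))) => v' Pv' v'v.
have ray i : rays_of (range D) (intv R (V (D i))) by exists (D i) => //; exists i.
rewrite lt_neqAle !pairing_sumr; apply/andP; split; last first.
  by apply: ler_sum => i _; apply: min.
apply/negP => /eqP e; apply: v'v; apply/eqP; rewrite -subr_eq0; apply/eqP.
have : \sum_i (pairing v' (intv R (V (D i))) - pairing v (intv R (V (D i)))) = 0.
  by rewrite big_split /= sumrN e subrr.
move/eqP; rewrite psumr_eq0 => [|i _]; last by rewrite subr_ge0 min.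
move=> /allP zero.
have vM : (v' - v) *m map_mx intr (column_matrix V D) = 0.
  apply/matrixP => i j; rewrite ord1 [RHS]mxE.
  have := zero j; rewrite mem_index_enum => /(_ isT)/= /eqP <-.
  rewrite mxE !pairingE -sumrB; apply: eq_bigr => k _.
  by rewrite !mxE mulrBl.
rewrite -[LHS]mulmx1 -(map_mx1 (intr : int -> R)) -(mulmxV uD) map_mxM mulmxA vM.
by rewrite mul0mx.
Qed.

(** A functional exposing a vertex lies in the cone of some basis clique, whose
    common minimizer must be that vertex. *)
Lemma inner_normal_fanE : inner_normal_fan P = clique_fan R V G K.
Proof.
rewrite (clique_fanE GK); apply/seteqP; split=> F.
  move=> [v [[Pv [w wmin]] vF]].
  have [f fr] := us_ex GK w; have [_ cf _] := fr.
  have [D [bD fD]] := us_basis GK cf.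
  have [v0 v0min] := clique_min (basis_clique_clique bD).
  have v0v : v0 = v.
    apply: contrapT => v0v; have [Pv0 min0] := v0min.
    have := wmin _ Pv0 v0v; apply/negP; rewrite -leNgt.
    have [f0 _ ->] := fr; rewrite !pairing_comb; apply: ler_sum => c _.
    have [->|fc] := eqVneq (f c) 0; first by rewrite !mul0r.
    by rewrite ler_wpM2l// min0//; exists c => //; exact: fD.
  exists (range D); split; first by apply/(maximal_cliqueP GK); exists D.
  by rewrite -(normal_cone_clique bD v0min) v0v.
move=> [A [/(maximal_cliqueP GK)[D bD ->] fF]].
have [v vmin] := clique_min (basis_clique_clique bD).
exists v; split; first exact: vertex_clique vmin.
by rewrite (normal_cone_clique bD vmin).
Qed.

End NormalFan.

(** * Windows and the pellytope *)

Section Pellytope.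
Variables (R : realType) (d n : nat).
Implicit Types (c : chord) (j k l : nat).

Definition corner j l : 'rV[R]_n := \row_i (j <= i.+1 < j + l)%N%:R.

Definition corner_multinom j l : 'X_{1..n} := [multinom (j <= i.+1 < j + l)%N : nat | i < n].

Lemma qpolyE k j :
  Defs.qpoly R n k j = \sum_(0 <= l < k.+1) 'X_[R, corner_multinom j l].
Proof.
apply: eq_bigr => l _; rewrite mpolyXE_id big_mkcond /=; apply: eq_bigr => i _.
by rewrite mnmE; case: ifP; rewrite ?expr1 ?expr0.
Qed.

Lemma newton_polytopeE k j :
  newton_polytope (Defs.qpoly R n k j) =
  convex_hull [set corner j l | l in [set l | (l <= k)%N]].
Proof.
rewrite /newton_polytope; congr convex_hull.
have cE l : \row_i ((corner_multinom j l i)%:R : R) = corner j l.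
  by apply/matrixP => i i'; rewrite !mxE mnmE.
have suppE m : m \in msupp (Defs.qpoly R n k j) <-> exists2 l, (l <= k)%N & m = corner_multinom j l.
  rewrite mcoeff_msupp qpolyE raddf_sum /=.
  under eq_bigr do rewrite mcoeffX.
  rewrite -natr_sum pnatr_eq0 sum_nat_seq_neq0; split.
    move=> /hasP[l]; rewrite mem_index_iota /= => lk.
    by rewrite eqb0 negbK => /eqP <-; exists l.
  move=> [l lk ->]; apply/hasP; exists l; last by rewrite /= eqxx.
  by rewrite mem_index_iota.
apply/seteqP; split=> x.
  by move=> [m /= /suppE[l lk ->] <-]; exists l => //; rewrite cE.
move=> [l lk <-]; exists (corner_multinom j l); last exact: cE.
by apply/suppE; exists l.
Qed.

(** A functional [w] is recorded by its partial sums, a function on the points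
    0, ..., n up to a constant.  The vector of a chord [ab] gives the indicator
    function of the points from [a - 1] to [b - 3], and [corner j l] evaluates
    the difference between the points [j - 1 + l] and [j - 1]. *)
Definition chord_interval c : pred nat := fun x => ((c.1 <= x.+1) && (x + 3 <= c.2))%N.

Lemma chord_vecE c (i : 'I_n) : dchord d n c ->
  intv R (chord_vec n c) i 0 = (chord_interval c i.+1)%:R - (chord_interval c i)%:R.
Proof.
case: c => a b dc; have := ltn_ord i; move: dc; rewrite mxE /chord_vec /chord_interval /=.
case=> /= [[-> b3 bn]|[-> a2 an]|[a2 ab bn ba _]] lin; rewrite /=.
- rewrite !mxE rmorphN rmorph_nat; apply/eqP.
  rewrite eq_sym subr_eq addrC -natrB; last by lia.
  by apply/eqP; congr _%:R; lia.
- have a1 : (a == 1)%N = false by lia.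
  rewrite a1 eqxx !mxE rmorph_nat -natrB; last by lia.
  by congr _%:R; lia.
have a1 : (a == 1)%N = false by lia.
have bn3 : (b == n + 3)%N = false by lia.
rewrite a1 bn3 !mxE rmorphB !rmorph_nat; apply/eqP.
rewrite subr_eq addrAC eq_sym subr_eq -!natrD; apply/eqP; congr _%:R; lia.
Qed.

Lemma pairing_corner c j l : dchord d n c -> (0 < j)%N -> (j + l <= n.+1)%N ->
  pairing (corner j l) (intv R (chord_vec n c)) =
  (chord_interval c (j.-1 + l)%N)%:R - (chord_interval c j.-1)%:R.
Proof.
move=> dc j0; elim: l => [|l IH] jl.
  rewrite addn0 subrr pairingE big1// => i _.
  by rewrite mxE addn0 ltnNge andbN mul0r.
have jn : (j.-1 + l < n)%N by lia.
have -> : corner j l.+1 = corner j l + delta_mx 0 (Ordinal jn).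
  apply/matrixP => a i; rewrite !mxE ord1 eqxx /= -natrD; congr _%:R.
  rewrite -val_eqE /=; lia.
rewrite pairingDl IH; last by lia.
have -> : pairing (delta_mx 0 (Ordinal jn)) (intv R (chord_vec n c)) =
    intv R (chord_vec n c) (Ordinal jn) 0.
  by rewrite /pairing -rowE mxE.
by rewrite chord_vecE//= addnS addrC addrA subrK.
Qed.

(** A point of the window [s, t] outside every interval of [A] that does not
    contain the window.  Take the point just after the last interval that
    contains [s] but not [t], or [s] itself.  An interval that covers it
    without containing [s] would cross that last one, with an overlap too small
    for the two to be compatible. *)
Lemma window_min (A : set chord) s t : A `<=` dchord d n ->
  pairwise_compatible d n A -> (s <= t <= n)%N -> (t - s <= d)%N ->
  exists2 x, (s <= x <= t)%N & forall c y, A c -> (s <= y <= t)%N ->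
    (chord_interval c x <= chord_interval c y)%N.
Proof.
move=> Ad AK stn tsd.
pose left_end x := x = s \/ exists c, [/\ A c, chord_interval c s,
  ~~ chord_interval c t & x = (c.2 - 2)%N].
have exE : exists x, `[< left_end x >] by exists s; apply/asboolP; left.
have bound x : `[< left_end x >] -> (x <= t)%N.
  move=> /asboolP[->|[c [_ + + ->]]]; first by lia.
  by rewrite /chord_interval; lia.
case: (ex_maxnP exE bound) => x /asboolP xE xmax.
exists x.
  rewrite bound ?andbT; last exact/asboolP.
  by case: xE => [->//|[c [_ + _ ->]]]; rewrite /chord_interval; lia.
move=> c y Ac syt.
case/boolP: (chord_interval c y) => [_|ncy]; first exact: leq_b1.
rewrite leqn0 eqb0; apply/negP => cx.
case/boolP: (chord_interval c s) => cs.
  (* c contains s but not the whole window, so its right end is at most x *)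
  have ct : ~~ chord_interval c t.
    by apply: contra ncy; move: cs; rewrite /chord_interval; lia.
  have /xmax : `[< left_end (c.2 - 2)%N >].
    by apply/asboolP; right; exists c.
  by move: cx; rewrite /chord_interval; lia.
case: xE => [xs|[c' [Ac' c's nc't xE]]]; first by move: cx; rewrite xs (negbTE cs).
have := AK _ _ Ac' Ac; have /dchordE := Ad _ Ac; have /dchordE := Ad _ Ac'.
move: cx cs c's nc't; rewrite xE /chord_interval /compatible /crossing /far_pair.
by case: c c' {ncy Ac Ac' xE} => a b [a' b'] /=; lia.
Qed.

(** Two incompatible intervals cross or are adjacent; the window that reaches
    one point beyond their overlap on each side is covered by their union but
    lies in neither, so no point minimizes both indicators. *)
Lemma window_incompatible c c' : dchord d n c -> dchord d n c' ->
  ~~ compatible d n c c' ->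
  exists s t, [/\ s < t, t <= n, t - s <= d &
    forall x, s <= x <= t -> exists2 y, s <= y <= t &
      chord_interval c y < chord_interval c x \/
      chord_interval c' y < chord_interval c' x]%N.
Proof.
wlog lt : c c' / (c.1 < c'.1)%N => [th dc dc'|].
  have [lt|] := ltnP c.1 c'.1; first exact: th.
  rewrite leq_eqVlt => /orP[/eqP e|lt].
    by rewrite /compatible /crossing e ltnn.
  rewrite compatibleC => /(th _ _ lt dc' dc)[s [t [st tn tsd h]]].
  by exists s, t; split=> // x /h[y yst yx]; exists y => //; case: yx; [right|left].
move=> dc dc' ncomp; exists (c'.1 - 2)%N, (c.2 - 2)%N.
have cross : [&& 0 < c.1, c'.1 < c.2, c.2 < c'.2, c'.2 <= n + 3 & c.2 - c'.1 <= d]%N.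
  move: dc dc' ncomp lt => /dchordE + /dchordE.
  rewrite /compatible /crossing /far_pair; case: c c' => a b [a' b'] /=; lia.
split; try (move: lt dc' cross => + /dchordE; case: c c' {dc ncomp} => a b [a' b'] /=; lia).
(* c vanishes at the right end of the window and c' at its left end, while
   no point of the window lies outside both intervals *)
move=> x xw; case/boolP: (chord_interval c x) => [cx|ncx].
  exists (c.2 - 2)%N; first by lia.
  left; move: cross; rewrite /chord_interval; lia.
exists (c'.1 - 2)%N; first by lia.
right; move: ncx cross dc' lt xw => + + /dchordE; rewrite /chord_interval.
by case: c c' {dc ncomp} => a b [a' b'] /=; lia.
Qed.

Lemma window_min_corner k j (A : set chord) : A `<=` dchord d n ->
  pairwise_compatible d n A -> (0 < j)%N -> (j + k <= n.+1)%N -> (k <= d)%N ->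
  exists v, minimizes [set corner j l | l in [set l | (l <= k)%N]]
    ((intv R \o chord_vec n) @` A) v.
Proof.
move=> Ad AK j0 jk kd.
have [| |x xw xmin] := @window_min A j.-1 (j.-1 + k) Ad AK; [lia|lia|].
exists (corner j (x - j.-1)); split; first by exists (x - j.-1)%N => //=; lia.
move=> _ _ [c Ac <-] [l /= lk <-]; have dc := Ad _ Ac.
rewrite !pairing_corner//; [|lia|lia].
rewrite lerD2r ler_nat subnKC; last by lia.
by apply: xmin => //; lia.
Qed.

Lemma corner_min_compatible c c' : dchord d n c -> dchord d n c' ->
  (forall k j, (0 < k <= d)%N -> (0 < j)%N -> (j + k <= n.+1)%N ->
     exists v, minimizes [set corner j l | l in [set l | (l <= k)%N]]
       ((intv R \o chord_vec n) @` [set c; c']) v) ->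
  compatible d n c c'.
Proof.
move=> dc dc' H; apply/negPn/negP => /(window_incompatible dc dc')[s [t [st tn tsd w]]].
have [| | |v [[l /= lk <-] min]] := H (t - s)%N s.+1; [lia|lia|lia|].
have [|y yst] := w (s + l)%N; first by lia.
have ys : corner s.+1 (y - s) \in [set corner s.+1 l | l in [set l | (l <= t - s)%N]].
  by rewrite inE; exists (y - s)%N => //=; lia.
rewrite inE in ys.
have le e : dchord d n e -> [set c; c'] e ->
    (chord_interval e (s + l)%N <= chord_interval e y)%N.
  move=> de cce; have := min (intv R (chord_vec n e)) _ _ ys.
  rewrite !pairing_corner//; [|lia|lia].
  rewrite lerD2r ler_nat subnKC; last by lia.
  by apply; exists e.
by case; rewrite ltnNge le//; [left|right].
Qed.

Lemma pellytope_min W : (d <= n)%N -> (exists v, minimizes (pellytope R d n) W v) <->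
  (forall k j, (0 < k <= d)%N -> (0 < j)%N -> (j + k <= n.+1)%N ->
     exists v, minimizes [set corner j l | l in [set l | (l <= k)%N]] W v).
Proof.
move=> dn; rewrite /pellytope big_minkowski_min; split=> [H k j kd j0 jk|H k].
  have := H k; rewrite mem_index_iota big_minkowski_min => /(_ kd)/(_ j).
  rewrite mem_index_iota newton_polytopeE convex_hull_min; apply; lia.
rewrite mem_index_iota => kd; rewrite big_minkowski_min => j.
rewrite mem_index_iota => jk; rewrite newton_polytopeE convex_hull_min.
apply: H; lia.
Qed.

Lemma pelly_fanE (G : seq chord) : (d <= n)%N ->
  unimodular_system R (chord_vec n) G (compatible d n) -> [set` G] = dchord d n ->
  pelly_fan R d n = clique_fan R (chord_vec n) G (compatible d n).
Proof.
move=> dn sG GE; apply: inner_normal_fanE => //.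
  move=> A [AG AK]; apply/(pellytope_min _ dn) => k j kd j0 jk.
  by apply: window_min_corner => //; [rewrite -GE|case/andP: kd].
have inG c : c \in G -> dchord d n c by rewrite -GE.
move=> c c' /inG dc /inG dc' /(pellytope_min _ dn) H.
exact: corner_min_compatible.
Qed.

End Pellytope.

(** * The chord diagram fan *)

Section Assembly.
Variables (R : realType) (n : nat).

Lemma admissibleE d (G : seq chord) : [set` G] = dchord d n ->
  admissible d n = maximal_clique G (compatible d n).
Proof.
move=> GE; apply/seteqP; split=> D; rewrite /maximal_clique /clique GE.
  by move=> [Dd DK Dmax]; split=> // B [Bd BK]; exact: Dmax.
by move=> [[Dd DK] Dmax]; split=> // B Bd BK; exact: Dmax.
Qed.

(** The injectivity of the labelling after the subdivision shows that the ray of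
    [r] is new. *)
Lemma edge_subdivision_rays (G : seq chord) (K : rel chord) p q r K' :
  edge_subdivision R (chord_vec n) G K p q r K' ->
  let Sigma := clique_fan R (chord_vec n) G K in
  let tau := label_cone R (chord_vec n) [set p; q] in
  let u := chord_vec n p in
  let u' := chord_vec n q in
  [/\ [/\ Sigma tau, smooth_cone tau, rays tau = [set u; u']
        & \dim <<[:: intv R u; intv R u']>> = 2%N],
      ~ fan_rays Sigma (chord_vec n r)
    & fan_rays (star_subdivision tau Sigma) =
        fan_rays Sigma `|` [set chord_vec n r]].
Proof.
move=> S Sigma tau u u'.
have [[GK cpq] sS] := (es_system S, edge_clique S, subdivision_system S).
have raysE : rays tau = [set u; u'] by exact: rays_edge S.
have uu' : u != u'.
  apply: contra (es_neq S) => /eqP e; apply/eqP.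
  exact: (label_inj GK) (es_p S) (es_q S) e.
split.
- split=> //; first by exists [set p; q].
    exact: clique_cone_smooth cpq.
  have [_ sim] := clique_cone_simplicial GK cpq.
  have /= := sim [:: u; u']; rewrite inE uu' => /(_ isT) fr.
  apply/eqP; apply: fr => w; rewrite !inE => /orP[] /eqP ->.
    by rewrite [X in X _]raysE; left.
  by rewrite [X in X _]raysE; right.
- rewrite (fan_rays_clique_fan GK) => -[c cG e].
  have cr : c = r.
    by apply: (label_inj sS) e; rewrite inE ?eqxx// (cG : c \in G) orbT.
  by have := es_new S; rewrite -cr (cG : c \in G).
- rewrite (star_subdivisionE S) (fan_rays_clique_fan sS) (fan_rays_clique_fan GK).
  apply/seteqP; split=> [_ [c /= + <-]|w].
    by rewrite inE => /orP[/eqP->|cG]; [right|left; exists c].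
  case=> [[c cG <-]|->]; first by exists c; rewrite //= inE (cG : c \in G) orbT.
  by exists r; rewrite //= inE eqxx.
Qed.

End Assembly.

Theorem mainTheorem1 (R : realType) (d n : nat) :
  (1 <= d <= n)%N ->
  [/\ (* the normal fan is the chord diagram fan; chords label its rays *)
      pelly_fan R d n = chord_fan R d n /\
      set_bij (dchord d n) (fan_rays (pelly_fan R d n)) (chord_vec n),
      (* spanning a cone is compatibility; maximal cones are diagrams *)
      (forall A : set chord, A `<=` dchord d n ->
         (pelly_fan R d n (chord_cone R n A) <-> pairwise_compatible d n A)) /\
      set_bij (admissible d n) (maximal_cones (pelly_fan R d n))
        (chord_cone R n),
      (* smooth, simplicial, flag *)
      [/\ is_fan (pelly_fan R d n), smooth_fan (pelly_fan R d n),
          simplicial_fan (pelly_fan R d n) & flag_fan (pelly_fan R d n)]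
    & (* star subdivisions *)
      (2 <= d)%N ->
      exists cs : seq chord,
        [/\ uniq cs,
            forall i j : nat, (i, j) \in cs <->
              [/\ 2 <= i, i < j, j <= n + 2 & j - i = d]%N,
            star_subdivisions (pelly_fan R d.-1 n) cs = pelly_fan R d n
          & forall t : nat, (t < size cs)%N ->
              let c := nth (0%N, 0%N) cs t in
              let Sigma := star_subdivisions (pelly_fan R d.-1 n) (take t cs) in
              let tau := crossing_cone R n c in
              let u := chord_vec n (1%N, c.2) in
              let u' := chord_vec n (c.1, (n + 3)%N) in
              [/\ crossing (1%N, c.2) (c.1, (n + 3)%N),
                  [/\ Sigma tau, smooth_cone tau, rays tau = [set u; u']
                    & \dim <<[:: intv R u; intv R u']>> = 2%N],
                  ~ fan_rays Sigma (chord_vec n c)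
                & fan_rays (star_subdivision tau Sigma) =
                    fan_rays Sigma `|` [set chord_vec n c]]]].
Proof.
move=> dn; have [d1 dn'] := andP dn.
have [G [sG GE]] := chord_system R dn.
have PE := pelly_fanE dn' sG GE.
rewrite PE; split.
- split.
    by rewrite (clique_fanE sG) /chord_fan (admissibleE GE).
  rewrite (fan_rays_clique_fan sG) -GE; split=> [c cG|c c'|u [c cG <-]].
  + by exists c.
  + by rewrite !inE; exact: (label_inj sG).
  + by exists c.
- split=> [A Ad|].
    rewrite (label_cone_fan sG); last by rewrite GE.
    by rewrite /clique GE; split=> [[]|].
  by rewrite (admissibleE GE); exact: maximal_cones_bij.
- split.
  + exact: clique_fan_is_fan sG.
  + by move=> _ [A cA <-]; exact: clique_cone_smooth cA.
  + by move=> _ [A cA <-]; exact: clique_cone_simplicial cA.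
  + exact: clique_fan_flag sG.
move=> d2; have dn1 : (1 <= d.-1 <= n)%N by lia.
have [G' [sG' GE']] := chord_system R dn1.
rewrite (pelly_fanE _ sG' GE'); last by lia.
have stage s : uniq s -> {subset s <= diagonals n d} -> _ :=
  fun us sd => stage_system (s := s) d2 sG' GE' us sd.
exists (diagonals n d); split.
- exact: diagonals_uniq.
- move=> i j; rewrite mem_diagonals; split=> [[i2 ji jn]|[i2 ij jn ji]]; split=> //; lia.
- have [||_] := stage (rev (diagonals n d)).
  + by rewrite rev_uniq diagonals_uniq.
  + by move=> c; rewrite mem_rev.
  rewrite revK => ->; rewrite (stage_compatible_diagonals (s := rev _)).
    apply: clique_fan_ext; rewrite GE -dchord_split; last by rewrite d2.
    rewrite -GE'; apply/seteqP; split=> c /=; rewrite mem_cat mem_rev.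
      by case/orP; [left|right].
    by case=> ->; rewrite ?orbT.
  by move=> c; rewrite mem_rev.
move=> t tcs c Sigma tau u u'.
have cd : c \in diagonals n d by exact: mem_nth.
pose s := rev (take t (diagonals n d)).
have sd : {subset s <= diagonals n d} by move=> x; rewrite mem_rev => /mem_take.
have us : uniq s by rewrite rev_uniq take_uniq// diagonals_uniq.
have cs : c \notin s.
  have := diagonals_uniq n d; rewrite -{1}(cat_take_drop t (diagonals n d)).
  rewrite (drop_nth (0, 0)%N tcs) cat_uniq => /and3P[_ /hasPn/(_ c) + _].
  by rewrite inE eqxx mem_rev => /(_ isT).
have [sS fS] := stage s us sd.
have SE : Sigma = clique_fan R (chord_vec n) (s ++ G') (stage_compatible n d s).
  by rewrite -fS revK.
have edge : edge_subdivision R (chord_vec n) (s ++ G') (stage_compatible n d s)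
    (1, c.2)%N (c.1, n + 3)%N c (stage_compatible n d (c :: s)).
  case: (c) cd cs => i j cd cs; apply: stage_edge => //.
  rewrite -GE' setUC; apply/seteqP; split=> x /=; rewrite mem_cat.
    by case/orP; [left|right].
  by case=> ->; rewrite ?orbT.
have [tauP newP raysP] := edge_subdivision_rays edge.
rewrite SE; split=> //.
by case: (c) cd => i j /mem_diagonals[? ? ?]; rewrite /crossing /=; lia.
Qed.
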